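(* Let $\mathcal{P}$ be a regular apeirohedron in $\mathbb{E}^3$ (one of the planar, blended or pure regular apeirohedra in the coordinates given in the context). Suppose that $\mathbf{\Lambda}$ is a rank-$3$ lattice group on $\mathbb{E}^3$ such that the quotient map $\pi_{\mathbf{\Lambda}}:\mathbb{E}^3\to\mathbb{T}^3_{\mathbf{\Lambda}}$ induces a symmetric toroidal realization of a finite regular polyhedron $\mathcal{P}_{\mathbf{\Lambda}}$. Then: (i) If $\mathcal{P}$ is a pure apeirohedron, then there exists $a>0$ such that $a^{-1}\mathbf{\Lambda}\in\{\mathbf{\Lambda}_{(1,0,0)},\mathbf{\Lambda}_{(1,1,0)},\mathbf{\Lambda}_{(1,1,1)}\}$. (ii) If $\mathcal{P}$ is one among $\{4,4\}$, $\{4,4\}\#\{\ \}$, $\{4,4\}\#\{\infty\}$ or the Petrial of one of these, then there exists a diagonal transformation $D=\mathrm{diag}(a,a,b)$ such that $\mathbf{\Lambda}D^{-1}\in\{\mathbf{\Lambda}_{(1,0,0)},\mathbf{\Lambda}_{(1,1,0)},\mathbf{\Lambda}_{(1,1,1)},\langle\mathbf{\Lambda}_{(1,1)},t_3\rangle\}$, where $t_3$ is the translation by $e_3$. (iii) If $\mathcal{P}$ is $\{3,6\}\#\{\infty\}$ or its Petrial $\{\infty,6\}_3\#\{\infty\}$, then there exists a diagonal transformation $D=\mathrm{diag}(a,a,b)$ such that $\mathbf{\Lambda}D^{-1}\in\{\langle\mathbf{\Lambda}^{\{3,6\}}_{(1,0)},t_3\rangle,\langle\mathbf{\Lambda}^{\{3,6\}}_{(1,1)},t_3\rangle,\langle\mathbf{\Lambda}^{\{3,6\}}_{(1,1)},t_1\rangle,\langle\mathbf{\Lambda}^{\{3,6\}}_{(1,1)},t_2\rangle\}$,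 where $t_1,t_2,t_3$ are the translations by $u_1+e_3$, $u_2+e_3$ and $e_3$ respectively. (iv) If $\mathcal{P}$ is $\{6,3\}\#\{\ \}$ or its Petrial $\{\infty,3\}_6\#\{\ \}$, then there exists a diagonal transformation $D=\mathrm{diag}(a,a,b)$ such that $\mathbf{\Lambda}D^{-1}\in\{\langle\mathbf{\Lambda}^{\{3,6\}}_{(1,0)},t_3\rangle,\langle\mathbf{\Lambda}^{\{3,6\}}_{(1,1)},t_3\rangle,\langle3\mathbf{\Lambda}^{\{3,6\}}_{(1,0)},t_1\rangle,\langle3\mathbf{\Lambda}^{\{3,6\}}_{(1,0)},t_2\rangle\}$, where $t_1,t_2,t_3$ are the translations by $u_1+u_2+e_3$, $2u_1-u_2+e_3$ and $e_3$ respectively. (v) If $\mathcal{P}$ is one among $\{3,6\}$, $\{6,3\}$, $\{3,6\}\#\{\ \}$, $\{6,3\}\#\{\infty\}$ or the Petrial of one of these, then there exists a diagonal transformation $D=\mathrm{diag}(a,a,b)$ such that $\mathbf{\Lambda}D^{-1}\in\{\langle\mathbf{\Lambda}^{\{3,6\}}_{(1,0)},t_3\rangle,\langle\mathbf{\Lambda}^{\{3,6\}}_{(1,1)},t_3\rangle\}$, where $t_3$ is the translation by $e_3$.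
   Context: Isometries act on the right; $o$ is the origin. Polyhedra. A polyhedron is a connected graph (its $1$-skeleton, parallel edges allowed) together with a family of subgraphs called faces such that every edge lies in at least one face, every face is a connected $2$-valent graph, and every vertex figure (the graph whose nodes are the edges at a given vertex, two being adjacent when they belong to a common face) is a connected $2$-valent graph. It is regular if its automorphism group acts transitively on flags (mutually incident triples vertex–edge–face). The apeirohedra. Each apeirohedron $\mathcal{P}$ below is given by a base vertex $v$ and isometries $R_0,R_1,R_2$ generating its symmetry group $G(\mathcal{P})$: the base edge is the segment from $v$ to $vR_0$, the base face is the union of the images of the base edge under $\langle R_0,R_1\rangle$, and the vertices, edges, faces of $\mathcal{P}$ are the images of these under $G(\mathcal{P})$. The Petrial of $\mathcal{P}$ is obtained by replacing $(R_0,R_1,R_2)$ by $(R_0R_2,R_1,R_2)$, with the same base vertex. Write $\sigma(x,y)=(\tfrac12x+\tfrac{\sqrt3}{2}y,\tfrac{\sqrt3}{2}x-\tfrac12y)$ and let $\alpha>0$ be an arbitrary parameter. Each entry lists $v$; then the images of $(x,y,z)$ under $R_0$; $R_1$; $R_2$. Planar (in the plane $z=0$): $\{4,4\}$: $o$; $(1-x,y,z)$; $(y,x,z)$; $(x,-y,z)$. $\{3,6\}$: $o$; $(1-x,y,z)$; $(\sigma(x,y),z)$; $(x,-y,z)$. $\{6,3\}$: $(\frac12,\frac{\sqrt3}{6},0)$; $(x,-y,z)$; $(\sigma(x,y),z)$; $(1-x,y,z)$. Blended: $\{4,4\}\#\{\ \}$: $o$; $(1-x,y,\alpha-z)$; $(y,x,z)$;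 $(x,-y,z)$. $\{6,3\}\#\{\ \}$: $(\frac12,\frac{\sqrt3}{6},0)$; $(x,-y,\alpha-z)$; $(\sigma(x,y),z)$; $(1-x,y,z)$. $\{3,6\}\#\{\ \}$: $o$; $(1-x,y,\alpha-z)$; $(\sigma(x,y),z)$; $(x,-y,z)$. $\{4,4\}\#\{\infty\}$: $o$; $(1-x,y,\alpha-z)$; $(y,x,-z)$; $(x,-y,z)$. $\{6,3\}\#\{\infty\}$: $(\frac12,\frac{\sqrt3}{6},0)$; $(x,-y,\alpha-z)$; $(\sigma(x,y),-z)$; $(1-x,y,z)$. $\{3,6\}\#\{\infty\}$: $o$; $(1-x,y,\alpha-z)$; $(\sigma(x,y),-z)$; $(x,-y,z)$. The planar and blended apeirohedra are those listed and their Petrials. Pure (all twelve): $\{4,6|4\}$: $o$; $(1-x,y,z)$; $(y,x,-z)$; $(x,z,y)$. $\{6,4|4\}$: $(\frac12,\frac12,0)$; $(x,z,y)$; $(y,x,-z)$; $(1-x,y,z)$. $\{6,6|3\}$: $o$; $(x,1-z,1-y)$; $(y,x,-z)$; $(x,z,y)$. $\{\infty,6\}_{4,4}$: $o$; $(1-x,z,y)$; $(y,x,-z)$; $(x,z,y)$. $\{\infty,4\}_{6,4}$: $(\frac12,\frac12,0)$; $(1-x,z,y)$; $(y,x,-z)$; $(1-x,y,z)$. $\{\infty,6\}_{6,3}$: $o$; $(x,1-y,1-z)$; $(y,x,-z)$; $(x,z,y)$. $\{6,6\}_4$: $o$; $(1-y,1-x,-z)$; $(x,z,y)$; $(y,x,-z)$.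 $\{4,6\}_6$: $o$; $(1-x,1-y,z)$; $(x,z,y)$; $(y,x,-z)$. $\{\infty,3\}^{(b)}$: $o$; $(1-y,1-x,-z)$; $(z,-y,x)$; $(y,x,-z)$. $\{\infty,3\}^{(a)}$: $o$; $(1-x,1-y,z)$; $(z,-y,x)$; $(y,x,-z)$. $\{6,4\}_6$: $(\frac12,\frac12,\frac12)$; $(y,x,-z)$; $(x,z,y)$; $(1-x,1-y,z)$. $\{\infty,4\}_{\cdot,*3}$: $(\frac12,\frac12,\frac12)$; $(y,x,-z)$; $(1-x,z,y)$; $(1-x,1-y,z)$. Lattices. A lattice group of rank $d$ is a group of translations generated by $d$ linearly independent translations; its lattice is the orbit of $o$. For a linear map $T$, $\mathbf{\Lambda}T$ is the lattice group with lattice $\{vT:v\in\Lambda\}$, and $a\mathbf{\Lambda}$ is the case of dilatation by $a$. The lattice groups $\mathbf{\Lambda}_{(1,0,0)},\mathbf{\Lambda}_{(1,1,0)},\mathbf{\Lambda}_{(1,1,1)}$ have lattices, respectively, $\mathbb{Z}^3$; integral vectors with even coordinate sum; integral vectors with all coordinates of the same parity. With $u_1=e_1$, $u_2=\frac12e_1+\frac{\sqrt3}{2}e_2$, the following are rank-$2$ lattice groups in the plane $z=0$: $\mathbf{\Lambda}_{(1,1)}$ with lattice generated by $e_1+e_2,e_1-e_2$; $\mathbf{\Lambda}^{\{3,6\}}_{(1,0)}$ with lattice generated by $u_1,u_2$; $\mathbf{\Lambda}^{\{3,6\}}_{(1,1)}$ with lattice generated by $u_1+u_2$, $2u_1-u_2$.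 Here $\mathrm{diag}(a,a,b)$ is invertible. Tori and realizations. $\mathbb{T}^3_{\mathbf{\Lambda}}=\mathbb{E}^3/\mathbf{\Lambda}$ with the quotient metric, $\pi_{\mathbf{\Lambda}}$ the quotient map. An isometry $S$ of $\mathbb{E}^3$ induces an isometry $\overline S$ of $\mathbb{T}^3_{\mathbf{\Lambda}}$ if $\pi_{\mathbf{\Lambda}}(xS)=\pi_{\mathbf{\Lambda}}(x)\overline S$ for all $x$. A graph in $\mathbb{T}^3_{\mathbf{\Lambda}}$ is a set of points (vertices) with a set of geodesic arcs (edges), each having two distinct vertices as endpoints and no vertex in its interior. ''$\pi_{\mathbf{\Lambda}}$ induces a symmetric toroidal realization of a finite regular polyhedron $\mathcal{P}_{\mathbf{\Lambda}}$'' means: the images under $\pi_{\mathbf{\Lambda}}$ of the vertices and edges of $\mathcal{P}$ form a (finite) graph in $\mathbb{T}^3_{\mathbf{\Lambda}}$; this graph, together with the images of the faces of $\mathcal{P}$ as faces, is a regular polyhedron $\mathcal{P}_{\mathbf{\Lambda}}$; and the isometries $R_0,R_1,R_2$ of $\mathbb{E}^3$ generating $G(\mathcal{P})$ induce isometries of $\mathbb{T}^3_{\mathbf{\Lambda}}$, through which all automorphisms of $\mathcal{P}_{\mathbf{\Lambda}}$ are realized. *)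

(* Defs.v *)
From mathcomp Require Import all_boot all_order all_algebra.
From mathcomp Require Import boolp classical_sets functions cardinality reals.
From Stdlib Require Import Relation_Operators.

Set Implicit Arguments.
Unset Strict Implicit.
Unset Printing Implicit Defensive.

Import Order.TTheory GRing.Theory Num.Theory.

Local Open Scope classical_set_scope.
Local Open Scope card_scope.
Local Open Scope ring_scope.

(** * Groups of transformations and of vectors *)

Definition transformation_group (T : Type) (H : set (T -> T)) : Prop :=
  [/\ H id,
      forall f g, H f -> H g -> H (g \o f) &
      forall f g, H f -> cancel f g -> cancel g f -> H g].

Definition group_gen (T : Type) (S : set (T -> T)) : set (T -> T) :=
  smallest (@transformation_group T) S.

Definition additive_group (V : zmodType) (H : set V) : Prop :=
  H 0 /\ forall x y, H x -> H y -> H (x - y).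

Definition span_int (V : zmodType) (S : set V) : set V :=
  smallest (@additive_group V) S.

(** * Polyhedra *)

(* The empty graph is not connected. *)
Definition connected_for (T : Type) (A : set T) (r : T -> T -> Prop) : Prop :=
  A !=set0 /\
  forall x y, A x -> A y ->
    clos_refl_trans T (fun u v => [/\ A u, A v & r u v]) x y.

(* A subgraph is given by its vertex set and its edge set.  Edges are objects
   in their own right, so that parallel edges are possible. *)
Definition subgraph (TV TE : Type) : Type := (set TV * set TE)%type.

Definition subgraph_image (TV TE TV' TE' : Type)
    (fV : TV -> TV') (fE : TE -> TE') (F : subgraph TV TE) : subgraph TV' TE' :=
  (fV @` F.1, fE @` F.2).

Record faced_graph (TV TE : Type) := FacedGraph {
  vertices : set TV;
  edges : set TE;
  incident : TV -> TE -> Prop;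
  faces : set (subgraph TV TE) }.

Section Polyhedra.
Variables (TV TE : Type) (Q : faced_graph TV TE).

Definition edges_at (B : set TE) (v : TV) : set TE :=
  [set e | B e /\ incident Q v e].

Definition ends (e : TE) : set TV :=
  [set v | vertices Q v /\ incident Q v e].

Definition is_graph : Prop := forall e, edges Q e -> ends e #= `I_2.

Definition is_subgraph (F : subgraph TV TE) : Prop :=
  [/\ F.1 `<=` vertices Q, F.2 `<=` edges Q &
      forall e, F.2 e -> ends e `<=` F.1].

Definition joined_in (B : set TE) (v w : TV) : Prop :=
  exists e, [/\ B e, incident Q v e & incident Q w e].

Definition connected_graph (F : subgraph TV TE) : Prop :=
  connected_for F.1 (joined_in F.2).

Definition two_valent (F : subgraph TV TE) : Prop :=
  forall v, F.1 v -> edges_at F.2 v #= `I_2.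

Definition vertex_figure_adj (e e' : TE) : Prop :=
  e <> e' /\ exists F, [/\ faces Q F, F.2 e & F.2 e'].

Definition vertex_figure_ok (v : TV) : Prop :=
  let nodes := edges_at (edges Q) v in
  connected_for nodes vertex_figure_adj /\
  forall e, nodes e ->
    [set e' | nodes e' /\ vertex_figure_adj e e'] #= `I_2.

Definition is_polyhedron : Prop :=
  [/\ is_graph, connected_graph (vertices Q, edges Q),
      forall F, faces Q F ->
        [/\ is_subgraph F, connected_graph F & two_valent F],
      forall e, edges Q e -> exists2 F, faces Q F & F.2 e &
      forall v, vertices Q v -> vertex_figure_ok v].

Definition is_automorphism (fV : TV -> TV) (fE : TE -> TE) : Prop :=
  [/\ set_bij (vertices Q) (vertices Q) fV,
      set_bij (edges Q) (edges Q) fE,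
      forall v e, vertices Q v -> edges Q e ->
        (incident Q (fV v) (fE e) <-> incident Q v e) &
      [set subgraph_image fV fE F | F in faces Q] = faces Q].

Definition is_flag (v : TV) (e : TE) (F : subgraph TV TE) : Prop :=
  [/\ vertices Q v, edges Q e, faces Q F &
      [/\ incident Q v e, F.1 v & F.2 e]].

Definition flag_transitive : Prop :=
  forall v e F v' e' F', is_flag v e F -> is_flag v' e' F' ->
    exists fV fE, [/\ is_automorphism fV fE, fV v = v', fE e = e' &
                      subgraph_image fV fE F = F'].

Definition is_regular_polyhedron : Prop := is_polyhedron /\ flag_transitive.

End Polyhedra.

(** * Euclidean space and the apeirohedra *)

Section Euclidean.
Variable R : realType.

Notation E3 := 'rV[R]_3.

Definition pt (x y z : R) : E3 := \row_i nth 0 [:: x; y; z] i.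

Definition coord_map (f : R -> R -> R -> E3) (p : E3) : E3 :=
  f (p 0 0) (p 0 1) (p 0 2).

Definition edist (x y : E3) : R :=
  Num.sqrt (\sum_i (x 0 i - y 0 i) ^+ 2).

Definition segment (x y : E3) : set E3 :=
  [set x + t *: (y - x) | t in [set t : R | 0 <= t <= 1]].

Record generators := Generators {
  base_vertex : E3;
  gen0 : E3 -> E3;
  gen1 : E3 -> E3;
  gen2 : E3 -> E3 }.

Section Apeirohedron.
Variable P : generators.

Definition base_edge : set E3 := segment (base_vertex P) (gen0 P (base_vertex P)).

(* The union defining the base face is a union of graphs: the face records the
   edges it is made of, and not only the point set covered by them. *)
Definition base_face : subgraph E3 (set E3) :=
  let G01 := group_gen [set gen0 P; gen1 P] in
  ([set g (base_vertex P) | g in G01], [set g @` base_edge | g in G01]).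

Definition symmetry_group : set (E3 -> E3) :=
  group_gen [set gen0 P; gen1 P; gen2 P].

Definition apeirohedron : faced_graph E3 (set E3) :=
  {| vertices := [set g (base_vertex P) | g in symmetry_group];
     edges := [set g @` base_edge | g in symmetry_group];
     incident := fun v e => e v;
     faces := [set subgraph_image g (fun e => g @` e) base_face
                 | g in symmetry_group] |}.

(* Isometries act on the right: R_0 R_2 is R_0 followed by R_2. *)
Definition petrial : generators :=
  Generators (base_vertex P) (gen2 P \o gen0 P) (gen1 P) (gen2 P).

End Apeirohedron.

Definition with_petrials (A : set generators) : set generators :=
  A `|` [set petrial P | P in A].

(* From base vertex and images of (x,y,z) under R_0, R_1, R_2. *)
Definition gens (v : E3) (f0 f1 f2 : R -> R -> R -> E3) : generators :=
  Generators v (coord_map f0) (coord_map f1) (coord_map f2).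

Definition sqrt3 : R := Num.sqrt 3.

Definition sigma_x (x y : R) : R := x / 2 + sqrt3 / 2 * y.
Definition sigma_y (x y : R) : R := sqrt3 / 2 * x - y / 2.

Definition origin : E3 := pt 0 0 0.
Definition v63 : E3 := pt (1 / 2) (sqrt3 / 6) 0.

(** Planar apeirohedra *)

Definition P44 := gens origin
  (fun x y z => pt (1 - x) y z)
  (fun x y z => pt y x z)
  (fun x y z => pt x (- y) z).

Definition P36 := gens origin
  (fun x y z => pt (1 - x) y z)
  (fun x y z => pt (sigma_x x y) (sigma_y x y) z)
  (fun x y z => pt x (- y) z).

Definition P63 := gens v63
  (fun x y z => pt x (- y) z)
  (fun x y z => pt (sigma_x x y) (sigma_y x y) z)
  (fun x y z => pt (1 - x) y z).

(** Blends with a segment, {p,q}#{ } *)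

Definition P44_segment (alpha : R) := gens origin
  (fun x y z => pt (1 - x) y (alpha - z))
  (fun x y z => pt y x z)
  (fun x y z => pt x (- y) z).

Definition P63_segment (alpha : R) := gens v63
  (fun x y z => pt x (- y) (alpha - z))
  (fun x y z => pt (sigma_x x y) (sigma_y x y) z)
  (fun x y z => pt (1 - x) y z).

Definition P36_segment (alpha : R) := gens origin
  (fun x y z => pt (1 - x) y (alpha - z))
  (fun x y z => pt (sigma_x x y) (sigma_y x y) z)
  (fun x y z => pt x (- y) z).

(** Blends with a linear apeirogon, {p,q}#{oo} *)

Definition P44_apeirogon (alpha : R) := gens origin
  (fun x y z => pt (1 - x) y (alpha - z))
  (fun x y z => pt y x (- z))
  (fun x y z => pt x (- y) z).

Definition P63_apeirogon (alpha : R) := gens v63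
  (fun x y z => pt x (- y) (alpha - z))
  (fun x y z => pt (sigma_x x y) (sigma_y x y) (- z))
  (fun x y z => pt (1 - x) y z).

Definition P36_apeirogon (alpha : R) := gens origin
  (fun x y z => pt (1 - x) y (alpha - z))
  (fun x y z => pt (sigma_x x y) (sigma_y x y) (- z))
  (fun x y z => pt x (- y) z).

(** Pure apeirohedra *)

(* {4,6|4} *)
Definition P46_4 := gens origin
  (fun x y z => pt (1 - x) y z)
  (fun x y z => pt y x (- z))
  (fun x y z => pt x z y).

(* {6,4|4} *)
Definition P64_4 := gens (pt (1 / 2) (1 / 2) 0)
  (fun x y z => pt x z y)
  (fun x y z => pt y x (- z))
  (fun x y z => pt (1 - x) y z).

(* {6,6|3} *)
Definition P66_3 := gens origin
  (fun x y z => pt x (1 - z) (1 - y))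
  (fun x y z => pt y x (- z))
  (fun x y z => pt x z y).

(* {oo,6}_{4,4} *)
Definition Poo6_44 := gens origin
  (fun x y z => pt (1 - x) z y)
  (fun x y z => pt y x (- z))
  (fun x y z => pt x z y).

(* {oo,4}_{6,4} *)
Definition Poo4_64 := gens (pt (1 / 2) (1 / 2) 0)
  (fun x y z => pt (1 - x) z y)
  (fun x y z => pt y x (- z))
  (fun x y z => pt (1 - x) y z).

(* {oo,6}_{6,3} *)
Definition Poo6_63 := gens origin
  (fun x y z => pt x (1 - y) (1 - z))
  (fun x y z => pt y x (- z))
  (fun x y z => pt x z y).

(* {6,6}_4 *)
Definition P66_sub4 := gens origin
  (fun x y z => pt (1 - y) (1 - x) (- z))
  (fun x y z => pt x z y)
  (fun x y z => pt y x (- z)).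

(* {4,6}_6 *)
Definition P46_sub6 := gens origin
  (fun x y z => pt (1 - x) (1 - y) z)
  (fun x y z => pt x z y)
  (fun x y z => pt y x (- z)).

(* {oo,3}^(b) *)
Definition Poo3_b := gens origin
  (fun x y z => pt (1 - y) (1 - x) (- z))
  (fun x y z => pt z (- y) x)
  (fun x y z => pt y x (- z)).

(* {oo,3}^(a) *)
Definition Poo3_a := gens origin
  (fun x y z => pt (1 - x) (1 - y) z)
  (fun x y z => pt z (- y) x)
  (fun x y z => pt y x (- z)).

(* {6,4}_6 *)
Definition P64_sub6 := gens (pt (1 / 2) (1 / 2) (1 / 2))
  (fun x y z => pt y x (- z))
  (fun x y z => pt x z y)
  (fun x y z => pt (1 - x) (1 - y) z).

(* {oo,4}_{.,*3} *)
Definition Poo4_star3 := gens (pt (1 / 2) (1 / 2) (1 / 2))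
  (fun x y z => pt y x (- z))
  (fun x y z => pt (1 - x) z y)
  (fun x y z => pt (1 - x) (1 - y) z).

Definition planar_apeirohedra : set generators :=
  with_petrials [set P44; P36; P63].

Definition blended_apeirohedra (alpha : R) : set generators :=
  with_petrials
    [set P44_segment alpha; P63_segment alpha; P36_segment alpha;
         P44_apeirogon alpha; P63_apeirogon alpha; P36_apeirogon alpha].

Definition pure_apeirohedra : set generators :=
  [set P46_4; P64_4; P66_3; Poo6_44; Poo4_64; Poo6_63;
       P66_sub4; P46_sub6; Poo3_b; Poo3_a; P64_sub6; Poo4_star3].

(** * Lattice groups *)

(* A lattice group is represented by its set of translation vectors, which is
   also its lattice, i.e. the orbit of the origin. *)
Definition is_lattice_group (d : nat) (L : set E3) : Prop :=
  exists2 B : 'M[R]_(d, 3), row_free B & L = span_int [set row i B | i in setT].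

Definition lattice_map (L : set E3) (T : 'M[R]_3) : set E3 :=
  [set v *m T | v in L].

Definition lattice_scale (a : R) (L : set E3) : set E3 :=
  [set a *: v | v in L].

(* The group generated by the lattice group L and the translation by t. *)
Definition adjoin (L : set E3) (t : E3) : set E3 := span_int (L `|` [set t]).

Definition diag_aab (a b : R) : 'M[R]_3 := diag_mx (pt a a b).

Definition e1 : E3 := pt 1 0 0.
Definition e2 : E3 := pt 0 1 0.
Definition e3 : E3 := pt 0 0 1.
Definition u1 : E3 := e1.
Definition u2 : E3 := (1 / 2) *: e1 + (sqrt3 / 2) *: e2.

Definition integral_vectors (C : set 'rV[int]_3) : set E3 :=
  [set map_mx intr c | c in C].

Definition Lambda100 : set E3 := integral_vectors setT.

Definition Lambda110 : set E3 :=
  integral_vectors [set c : 'rV[int]_3 | (2 %| (\sum_i c 0 i)%R)%Z].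

Definition Lambda111 : set E3 :=
  integral_vectors [set c : 'rV[int]_3 | forall i j, (c 0%R i = c 0%R j %[mod 2])%Z].

Definition Lambda11 : set E3 := span_int [set e1 + e2; e1 - e2].

Definition Lambda36_10 : set E3 := span_int [set u1; u2].

Definition Lambda36_11 : set E3 := span_int [set u1 + u2; 2 *: u1 - u2].

(** * Flat tori *)

Section Torus.
Variable L : set E3.

Definition coset (x : E3) : set E3 := [set x + l | l in L].

Definition torus : Type := {p : set E3 | range coset p}.

Definition torus_proj (x : E3) : torus :=
  exist (range coset) (coset x) (imageT coset x).

Definition torus_dist (p q : torus) : R :=
  inf [set edist x y | x in sval p & y in sval q].

Definition is_torus_isometry (S : torus -> torus) : Prop :=
  bijective S /\ forall p q, torus_dist (S p) (S q) = torus_dist p q.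

Definition induces (S : E3 -> E3) (S' : torus -> torus) : Prop :=
  is_torus_isometry S' /\ forall x, torus_proj (S x) = S' (torus_proj x).

(* Geodesics are the images of straight segments (they need not be shortest);
   being an arc means having no self-intersection. *)
Definition is_geodesic_arc (p q : torus) (A : set torus) : Prop :=
  exists x y : E3, [/\ set_inj (segment x y) torus_proj,
    torus_proj x = p, torus_proj y = q & A = torus_proj @` segment x y].

Definition is_torus_graph (V : set torus) (E : set (set torus)) : Prop :=
  forall A, E A -> exists p q,
    [/\ V p, V q, p <> q, is_geodesic_arc p q A &
        forall w, V w -> A w -> w = p \/ w = q].

(* In a graph in the torus an edge contains no vertices but its endpoints, so
   that membership is the incidence of vertices and edges. *)
Definition toroidal_image (P : faced_graph E3 (set E3)) :
    faced_graph torus (set torus) :=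
  let projE := fun e : set E3 => torus_proj @` e in
  {| vertices := torus_proj @` vertices P;
     edges := projE @` edges P;
     incident := fun p A => A p;
     faces := subgraph_image torus_proj projE @` faces P |}.

Definition symmetric_toroidal_realization (P : generators) : Prop :=
  let Q := toroidal_image (apeirohedron P) in
  [/\ finite_set (vertices Q) /\ finite_set (edges Q),
      is_torus_graph (vertices Q) (edges Q),
      is_regular_polyhedron Q &
      exists S0 S1 S2 : torus -> torus,
        [/\ induces (gen0 P) S0, induces (gen1 P) S1, induces (gen2 P) S2 &
            forall fV fE, is_automorphism Q fV fE ->
              exists2 S, group_gen [set S0; S1; S2] S &
                (forall p, vertices Q p -> fV p = S p) /\
                (forall A, edges Q A -> fE A = S @` A)]].

End Torus.

End Euclidean.

Arguments P44 {R}.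
Arguments P36 {R}.
Arguments P63 {R}.
Arguments origin {R}.
Arguments e1 {R}.
Arguments e2 {R}.
Arguments e3 {R}.
Arguments u1 {R}.
Arguments u2 {R}.
Arguments planar_apeirohedra {R}.
Arguments pure_apeirohedra {R}.
Arguments Lambda100 {R}.
Arguments Lambda110 {R}.
Arguments Lambda111 {R}.
Arguments Lambda11 {R}.
Arguments Lambda36_10 {R}.
Arguments Lambda36_11 {R}.

(* Main.v *)
Require Import Defs.
From mathcomp Require Import all_boot all_order all_algebra.
From mathcomp Require Import boolp classical_sets functions cardinality reals.
From mathcomp Require Import zify ring lra.

Set Implicit Arguments.
Unset Strict Implicit.
Unset Printing Implicit Defensive.
Import Order.TTheory GRing.Theory Num.Theory.

Local Open Scope classical_set_scope.
Local Open Scope ring_scope.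

(** Only the linear parts of [R_0], [R_1], [R_2] matter.  If an isometry [S]
    descends to the torus, then [S] maps points congruent modulo the lattice [L]
    to congruent points, so its linear part maps [L] into itself.  Hence [L] is
    invariant under the special group of the apeirohedron, and also under the
    central inversion, being a group.  A Petrial has the same special group,
    because [R_2] is an involution ([preserved_by_petrials]).  It remains to
    classify the lattices invariant under each of these point groups.

    Square case.  The invariance under the sign changes of [x], [y] and [z]
    shows that [L] contains [(2x, 0, 0)] and [(0, 0, 2z)] whenever it contains
    [(x, y, z)].  As [L] meets each line through [o] in a cyclic group, the
    abscissae of [L] form a group [a Z] and its heights a group [b Z]; thus [L]
    lies between [2aZ x 2aZ x 2bZ] and [aZ x aZ x bZ] and is described by a
    subspace of [F_2^3].  This subspace is stable under the exchange of the
    first two coordinates and projects onto every coordinate, which leaves four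
    possibilities ([square_lattices]).  A pure apeirohedron has the full
    octahedral group up to the central inversion; the further exchange of [y]
    and [z] forces [a = b] and excludes one of the four ([cubic_lattices]).

    Hexagonal case.  Write vectors in the basis [u_1, u_2, e_3].  For the
    rotation [rho] of order three about the [z]-axis, [v - v rho] lies in the
    plane [z = 0] and [v + v rho + v rho^2] on the [z]-axis; with the
    reflections of the planar part this confines [L] to [aZ x aZ x bZ], with
    [3aZ x 3aZ x 0] contained in [L], and the planar part is either [3a] times
    the triangular lattice or [a] times its sublattice of index three.  A vector
    of the first layer above the plane can be reduced to three candidates in
    each case, so that six families of lattices remain ([hexagonal_lattices]).
    A reflection in the vertical plane through [u_1] rules out the two sheared
    lattices over the triangular lattice, and one in the vertical plane through
    [u_1 + u_2] those over the sublattice.  The point group contains the former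
    for [{3,6}#{oo}], the latter for [{6,3}#{ }], and both for the other planar
    and blended apeirohedra of hexagonal type. *)

(** * Groups of vectors *)

Section Groups.
Variable V : zmodType.
Implicit Types S H : set V.

Lemma span_int_additive S : additive_group (span_int S).
Proof.
split=> [G [[]] //|x y Sx Sy G GS].
by case: (GS) => [[_ GB] _]; apply: GB; [apply: Sx|apply: Sy].
Qed.

Lemma sub_span_int S : S `<=` span_int S.
Proof. by move=> x Sx G [_]; apply. Qed.

Lemma span_int_min S H : additive_group H -> S `<=` H -> span_int S `<=` H.
Proof. by move=> HH SH x; apply. Qed.

Variable H : set V.
Hypothesis HH : additive_group H.

Lemma additiveN x : H x -> H (- x).
Proof. by move=> Hx; rewrite -sub0r; apply: HH.2 => //; apply: HH.1. Qed.

Lemma additiveD x y : H x -> H y -> H (x + y).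
Proof. by move=> Hx /additiveN Hy; rewrite -[y]opprK; apply: HH.2. Qed.

Lemma additive_mulz x (n : int) : H x -> H (x *~ n).
Proof.
have nat (k : nat) : H x -> H (x *+ k).
  move=> Hx; elim: k => [|k IH]; first exact: HH.1.
  by rewrite mulrS; apply: additiveD.
case: n => n Hx; first exact: nat.
by rewrite NegzE mulrNz; apply/additiveN/nat.
Qed.

End Groups.

(** A subgroup of the reals that sits inside a cyclic group [c Z] is cyclic, by
    division with remainder. *)
Lemma cyclic_subgroup (R : realType) (A : set R) (c : R) :
    additive_group A ->
    (forall x, A x -> exists n : int, x = c * n%:~R) ->
    (exists2 x, A x & x != 0) ->
  exists2 a, 0 < a & forall x, A x <-> exists n : int, x = a * n%:~R.
Proof.
move=> AA Ac [x Ax x0].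
have Ac' y : A y -> exists n : int, y = `|c| * n%:~R.
  move=> /Ac[n ->]; case: (ger0P c) => _; first by exists n.
  by exists (- n); ring.
pose p k := `[< (0 < k)%N /\ A (`|c| * k%:R) >].
have exp : exists k, p k.
  have [n xn] := Ac' _ Ax; exists `|n|%N; apply/asboolP; split.
    by rewrite absz_gt0; apply: contraNneq x0 => n0; rewrite xn n0 mulr0.
  case: n xn => n xn; first by rewrite -xn.
  by have /(additiveN AA) := Ax; rewrite xn NegzE intrN mulrN opprK abszN.
have c0 : 0 < `|c|.
  by rewrite normr_gt0; apply: contraNneq x0 => c0; have [n ->] := Ac _ Ax; rewrite c0 mul0r.
case: (ex_minnP exp) => k /asboolP[k0 Ak] kmin.
exists (`|c| * k%:R) => [|y]; first by rewrite mulr_gt0 ?ltr0n.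
split=> [Ay|[n ->]]; last by rewrite mulrzr; apply: additive_mulz.
have [n yn] := Ac' _ Ay; exists (n %/ k)%Z.
suff r0 : (n %% k)%Z = 0.
  by rewrite yn [in LHS](divz_eq n k) r0 addr0 intrM; ring.
have [r rE] : exists r : nat, (n %% k)%Z = r by exists `|(n %% k)%Z|%N; lia.
case: (posnP r) => [r0|r_gt0]; first by rewrite rE r0.
have : (k <= r)%N; last by lia.
apply: kmin; apply/asboolP; split => //.
suff -> : `|c| * r%:R = y - `|c| * k%:R * (n %/ k)%Z%:~R.
  by apply: AA.2 => //; rewrite mulrzr; apply: additive_mulz.
have -> : y = `|c| * ((n %/ k)%Z * k + r)%:~R by rewrite yn -rE -divz_eq.
by rewrite intrD intrM; ring.
Qed.

(** * Coordinates *)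

Section Coordinates.
Variable R : realType.
Implicit Types (L : set 'rV[R]_3) (a b c x y z : R).

Lemma ptK x y z : (pt x y z 0 0 = x) * (pt x y z 0 1 = y) * (pt x y z 0 2 = z).
Proof. by rewrite !mxE. Qed.

Lemma row3P (v w : 'rV[R]_3) :
  v 0 0 = w 0 0 -> v 0 1 = w 0 1 -> v 0 2 = w 0 2 -> v = w.
Proof.
move=> h0 h1 h2; apply/rowP => -[[|[|[|//]]] i3].
- by rewrite (_ : Ordinal i3 = 0) //; apply: val_inj.
- by rewrite (_ : Ordinal i3 = 1) //; apply: val_inj.
- by rewrite (_ : Ordinal i3 = 2) //; apply: val_inj.
Qed.

Lemma pt_eta (v : 'rV[R]_3) : v = pt (v 0 0) (v 0 1) (v 0 2).
Proof. by apply: row3P; rewrite ptK. Qed.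

Lemma ptB x y z x' y' z' : pt x y z - pt x' y' z' = pt (x - x') (y - y') (z - z').
Proof. by apply: row3P; rewrite mxE [in X in _ + X]mxE !ptK. Qed.

Lemma ptZ a x y z : a *: pt x y z = pt (a * x) (a * y) (a * z).
Proof. by apply: row3P; rewrite mxE !ptK. Qed.

Lemma ptD x y z x' y' z' : pt x y z + pt x' y' z' = pt (x + x') (y + y') (z + z').
Proof. by apply: row3P; rewrite mxE !ptK. Qed.

Lemma pt0 : pt 0 0 0 = 0 :> 'rV[R]_3.
Proof. by apply: row3P; rewrite ptK mxE. Qed.

Lemma pt_mulmx d x y z (T : 'M[R]_(3, d)) :
  pt x y z *m T = x *: row 0 T + y *: row 1 T + z *: row 2 T.
Proof.
rewrite mulmx_sum_row !big_ord_recl big_ord0 addr0 addrA.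
rewrite (_ : lift ord0 ord0 = 1); last exact: val_inj.
by rewrite (_ : lift ord0 (lift ord0 ord0) = 2) ?ptK //; apply: val_inj.
Qed.

Lemma pt_diag x y z a b : pt x y z *m diag_aab a b = pt (x * a) (y * a) (z * b).
Proof.
by apply: row3P; rewrite mul_mx_diag mxE !ptK.
Qed.

Lemma diag_aab_unit a b : a != 0 -> b != 0 -> diag_aab a b \in unitmx.
Proof.
move=> a0 b0; rewrite unitmxE /diag_aab det_diag unitfE; apply/prodf_neq0 => i _.
by rewrite mxE; case: i => -[|[|[|]]].
Qed.

End Coordinates.

(** * Lattice groups *)

Section Lattices.
Variable R : realType.
Implicit Types (L : set 'rV[R]_3) (a b c x y z : R).

Lemma lattice_additive d L : is_lattice_group d L -> additive_group L.
Proof. by case=> B _ ->; apply: span_int_additive. Qed.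

Lemma lattice_mapP L T v : T \in unitmx -> lattice_map L (invmx T) v <-> L (v *m T).
Proof.
move=> Tu; split=> [[w Lw <-]|Lv]; first by rewrite mulmxKV.
by exists (v *m T); rewrite ?mulmxK.
Qed.

(** This replaces discreteness: in a basis of the lattice the vectors of the
    lattice on the line through [e] have integral coordinates proportional to
    those of [e], and any nonzero coordinate of [e] gives [c]. *)
Lemma lattice_line L (e : 'rV[R]_3) : is_lattice_group 3 L -> e != 0 ->
  exists c, forall x, L (x *: e) -> exists n : int, x = c * n%:~R.
Proof.
case=> B Bfree -> e0; have Bu : B \in unitmx by rewrite -row_free_unit.
pose H := [set v : 'rV[R]_3 | exists n : 'rV[int]_3, v *m invmx B = map_mx intr n].
have Hadd : additive_group H.
  split=> [|v w [m hm] [n hn]]; first by exists 0; rewrite mul0mx map_mx0.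
  by exists (m - n); rewrite mulmxBl hm hn map_mxB.
have subH : span_int [set row i B | i in setT] `<=` H.
  apply: span_int_min => // _ [i _ <-]; exists (delta_mx 0 i).
  by rewrite rowE mulmxK // map_delta_mx.
have /rV0Pn[j ej] : e *m invmx B != 0.
  by apply: contra_neq e0 => h; rewrite -(mulmxKV Bu e) h mul0mx.
exists ((e *m invmx B) 0 j)^-1 => x /subH[n hn]; exists (n 0 j).
have := congr1 (fun w : 'rV_3 => w 0 j) hn.
by rewrite -scalemxAl mxE [RHS]mxE => <-; rewrite mulrCA mulVf ?mulr1.
Qed.

(** Full rank makes the groups of abscissae and of heights below nonzero. *)
Lemma lattice_spans L (u : 'cV[R]_3) : is_lattice_group 3 L -> u != 0 ->
  exists2 v, L v & (v *m u) 0 0 != 0.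
Proof.
case=> B Bfree -> u0; have Bu : B \in unitmx by rewrite -row_free_unit.
have : B *m u != 0.
  by apply: contra_neq u0 => h; rewrite -(mulKmx Bu u) h mulmx0.
case/cV0Pn => i hi; exists (row i B).
  by apply: sub_span_int; exists i.
by rewrite -row_mul mxE.
Qed.

Lemma lattice_group_map L T : T \in unitmx -> is_lattice_group 3 L ->
  is_lattice_group 3 (lattice_map L (invmx T)).
Proof.
move=> Tu [B Bfree ->]; exists (B *m invmx T).
  by rewrite row_free_unit unitmx_mul unitmx_inv Tu -row_free_unit Bfree.
apply/seteqP; split.
  move=> _ [v Sv <-]; move: v Sv; apply: span_int_min; last first.
    by move=> _ [i _ <-]; apply: sub_span_int; exists i; rewrite ?row_mul.
  have [h0 hB] := span_int_additive [set row i (B *m invmx T) | i in setT].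
  split=> [|v w hv hw] /=; first by rewrite mul0mx.
  by rewrite mulmxBl; apply: hB.
apply: span_int_min; last first.
  by move=> _ [i _ <-]; exists (row i B); [apply: sub_span_int; exists i|rewrite row_mul].
have [h0 hB] := span_int_additive [set row i B | i in setT].
split=> [|_ _ [v hv <-] [w hw <-]]; first by exists 0; rewrite ?mul0mx.
by exists (v - w); [apply: hB|rewrite mulmxBl].
Qed.

(** Every lattice below is described by [a], [b] and a congruence condition [C]
    on integral coordinates. *)
Definition int_box a b (C : int -> int -> int -> Prop) : set 'rV[R]_3 :=
  [set v | exists m n k : int,
     C m n k /\ v = pt (a * m%:~R) (a * n%:~R) (b * k%:~R)].

Lemma int_box_mulmx a b C v : a != 0 -> b != 0 ->
  int_box a b C (v *m diag_aab a b) <-> int_box 1 1 C v.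
Proof.
move=> a0 b0; rewrite [v]pt_eta pt_diag.
split=> -[m [n [k [Cmnk h]]]]; exists m, n, k; split=> //.
  have H i := congr1 (fun w : 'rV_3 => w 0 i) h.
  move: (H 0) (H 1) (H 2); rewrite !ptK !mul1r => {h H} h0 h1 h2.
  by congr pt; [apply: (mulIf a0)|apply: (mulIf a0)|apply: (mulIf b0)]; rewrite ?h0 ?h1 ?h2 mulrC.
have H i := congr1 (fun w : 'rV_3 => w 0 i) h.
by move: (H 0) (H 1) (H 2); rewrite !ptK !mul1r => -> -> ->; congr pt; rewrite mulrC.
Qed.

Lemma adjoin_span2 (g1 g2 t : 'rV[R]_3) :
  adjoin (span_int [set g1; g2]) t =
  [set v | exists m n k : int, v = m%:~R *: g1 + n%:~R *: g2 + k%:~R *: t].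
Proof.
apply/seteqP; split; last first.
  move=> _ [m [n [k ->]]].
  have hS := @sub_span_int _ (span_int [set g1; g2] `|` [set t]).
  have AA := span_int_additive (span_int [set g1; g2] `|` [set t]).
  rewrite !scaler_int; apply: (additiveD AA); first apply: (additiveD AA);
    apply: (additive_mulz AA); apply: hS.
  - by left; apply: sub_span_int; left.
  - by left; apply: sub_span_int; right.
  - by right.
set H := (X in _ `<=` X).
have HH : additive_group H.
  split=> [|_ _ [m [n [k ->]]] [m' [n' [k' ->]]]].
    by exists 0, 0, 0; rewrite !scale0r !addr0.
  exists (m - m'), (n - n'), (k - k'); rewrite !intrB.
  by apply/rowP => i; rewrite !mxE; ring.
apply: span_int_min => // v [|->]; last by exists 0, 0, 1; rewrite !scale0r !add0r scale1r.
apply: span_int_min v => // v [->|->]; first by exists 1, 0, 0; rewrite !scale0r !addr0 scale1r.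
by exists 0, 1, 0; rewrite !scale0r addr0 add0r scale1r.
Qed.

Lemma lattice_scale_span2 (c : R) (g1 g2 : 'rV[R]_3) :
  lattice_scale c (span_int [set g1; g2]) = span_int [set c *: g1; c *: g2].
Proof.
apply/seteqP; split.
  move=> _ [v hv <-]; move: v hv; apply: span_int_min; last first.
    by move=> v [->|->]; apply: sub_span_int; [left|right].
  have [h0 hB] := span_int_additive [set c *: g1; c *: g2].
  split=> [|v w hv hw] /=; first by rewrite scaler0.
  by rewrite scalerBr; apply: hB.
have [h0 hB] := span_int_additive [set g1; g2].
apply: span_int_min; last first.
  by move=> v [->|->]; [exists g1|exists g2] => //; apply: sub_span_int; [left|right].
split=> [|_ _ [v hv <-] [w hw <-]]; first by exists 0; rewrite ?scaler0.
by exists (v - w); [apply: hB|rewrite scalerBr].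
Qed.

End Lattices.

(** * Lattices invariant under a point group *)

Section Classification.
Variable R : realType.
Implicit Types (L : set 'rV[R]_3) (a b c x y z : R).

Lemma int_boxP a b C (m n k : int) : a != 0 -> b != 0 ->
  int_box a b C (pt (a * m%:~R) (a * n%:~R) (b * k%:~R)) <-> C m n k.
Proof.
move=> a0 b0; split=> [[m' [n' [k' [Cmnk h]]]]|]; last by exists m, n, k.
have H i := congr1 (fun w : 'rV_3 => w 0 i) h.
move: (H 0) (H 1) (H 2); rewrite !ptK => /(mulfI a0) + /(mulfI a0) + /(mulfI b0).
by move=> /intr_inj -> /intr_inj -> /intr_inj ->.
Qed.

Lemma eq_int_box a b C C' : (forall m n k, C m n k <-> C' m n k) ->
  int_box a b C = int_box a b C'.
Proof.
move=> CC'; apply/seteqP; split=> _ [m [n [k [/CC' h ->]]]]; exists m, n, k; split=> //.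
Qed.

Lemma lattice_not_in_plane L a b c : is_lattice_group 3 L -> pt a b c != 0 ->
  exists x y z, L (pt x y z) /\ a * x + b * y + c * z != 0.
Proof.
move=> Llat abc0; have [|v Lv v0] := @lattice_spans _ L (pt a b c)^T Llat.
  by rewrite trmx_eq0.
exists (v 0 0), (v 0 1), (v 0 2); rewrite -pt_eta; split=> //.
apply: contra_neq v0 => <-; rewrite [in LHS](pt_eta v) pt_mulmx !mxE /=.
by rewrite [_ * a]mulrC [_ * b]mulrC [_ * c]mulrC.
Qed.

Lemma lattice_xline L : is_lattice_group 3 L ->
  exists c, forall x, L (pt x 0 0) -> exists n : int, x = c * n%:~R.
Proof.
move=> Llat; have [|c hc] := @lattice_line _ L (pt 1 0 0) Llat.
  by apply/rV0Pn; exists 0; rewrite ptK oner_neq0.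
by exists c => x Lx; apply: hc; rewrite ptZ !mulr0 mulr1.
Qed.

Lemma lattice_zline L : is_lattice_group 3 L ->
  exists c, forall z, L (pt 0 0 z) -> exists n : int, z = c * n%:~R.
Proof.
move=> Llat; have [|c hc] := @lattice_line _ L (pt 0 0 1) Llat.
  by apply/rV0Pn; exists 2; rewrite ptK oner_neq0.
by exists c => x Lx; apply: hc; rewrite ptZ !mulr0 mulr1.
Qed.

Lemma pt_neq0 i (a b c : R) : pt a b c 0 i != 0 -> pt a b c != 0.
Proof. by move=> h; apply/rV0Pn; exists i. Qed.

(** The heights of the lattice form a cyclic group as soon as a nonzero multiple
    of the vertical projection maps the lattice into itself, since they then
    embed into the lattice vectors on the [z]-axis. *)
Lemma heights_cyclic L (s : int) : is_lattice_group 3 L -> s != 0 ->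
    (forall x y z, L (pt x y z) -> L (pt 0 0 (s%:~R * z))) ->
  exists2 b, 0 < b &
    forall z, (exists x y, L (pt x y z)) <-> exists n : int, z = b * n%:~R.
Proof.
move=> Llat s0 hs; have LA := lattice_additive Llat.
have s0' : s%:~R != 0 :> R by rewrite intr_eq0.
have [c hc] := lattice_zline Llat.
apply: (@cyclic_subgroup _ [set z | exists x y, L (pt x y z)] (c / s%:~R)).
- split=> [|z z' [x [y Lz]] [x' [y' Lz']]]; first by exists 0, 0; rewrite pt0; apply: LA.1.
  by exists (x - x'), (y - y'); rewrite -ptB; apply: LA.2.
- by move=> z [x [y /hs/hc[n hn]]]; exists n; rewrite mulrAC -hn mulrAC mulfV ?mul1r.
have [|x [y [z [Lz]]]] := lattice_not_in_plane (a := 0) (b := 0) (c := 1) Llat.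
  by apply: (pt_neq0 (i := 2)); rewrite ptK oner_neq0.
by rewrite !mul0r !add0r mul1r; exists z => //; exists x, y.
Qed.

Lemma int_combination L a b m n k m' n' k' : additive_group L ->
  L (pt (a * m%:~R) (a * n%:~R) (b * k%:~R)) ->
  L (pt (a * m'%:~R) (a * n'%:~R) (b * k'%:~R)) ->
  forall i j : int,
  L (pt (a * (i * m + j * m')%:~R) (a * (i * n + j * n')%:~R)
        (b * (i * k + j * k')%:~R)).
Proof.
move=> LA h h' i j.
have := additiveD LA (additive_mulz LA i h) (additive_mulz LA j h').
rewrite -!scaler_int !ptZ ptD.
by congr (L (pt _ _ _)); rewrite intrD !intrM; ring.
Qed.

(** The integral coordinates of [L] contain [2 Z^3], so only their parities
    matter; which of the vectors [(1,0,0)], [(0,0,1)], [(1,1,0)] they contain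
    decides between the four codes in [F_2^3]. *)
Lemma square_lattices L : is_lattice_group 3 L ->
    (forall x y z, L (pt x y z) -> L (pt (- x) y z)) ->
    (forall x y z, L (pt x y z) -> L (pt x y (- z))) ->
    (forall x y z, L (pt x y z) -> L (pt y x z)) ->
  exists a b, [/\ 0 < a, 0 < b &
    [\/ L = int_box a b (fun _ _ _ => True),
        L = int_box a b (fun m n k => (2 %| m + n + k)%Z),
        L = int_box a b (fun m n k => (2 %| m - n)%Z /\ (2 %| n - k)%Z) |
        L = int_box a b (fun m n _ => (2 %| m + n)%Z)]].
Proof.
move=> Llat hx hz hxy; have LA := lattice_additive Llat.
have hz2 x y z : L (pt x y z) -> L (pt 0 0 (2%:~R * z)).
  move=> h; have /(LA.2 _ _ h) := hz _ _ _ h; rewrite ptB.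
  by congr (L (pt _ _ _)); ring.
have hx2 x y z : L (pt x y z) -> L (pt (2 * x) 0 0).
  move=> h; have /(LA.2 _ _ h) := hx _ _ _ h; rewrite ptB.
  by congr (L (pt _ _ _)); ring.
have [b b0 bP] := heights_cyclic (s := 2) Llat isT hz2.
have [a a0 aP] : exists2 a, 0 < a &
    forall x, (exists y z, L (pt x y z)) <-> exists n : int, x = a * n%:~R.
  have [c hc] := lattice_xline Llat.
  apply: (@cyclic_subgroup _ [set x | exists y z, L (pt x y z)] (c / 2)).
  - split=> [|x x' [y [z Lz]] [y' [z' Lz']]].
      by exists 0, 0; rewrite pt0; apply: LA.1.
    by exists (y - y'), (z - z'); rewrite -ptB; apply: LA.2.
  - by move=> x [y [z /hx2/hc[n hn]]]; exists n; lra.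
  have [|x [y [z [Lz]]]] := lattice_not_in_plane (a := 1) (b := 0) (c := 0) Llat.
    by apply: (pt_neq0 (i := 0)); rewrite ptK oner_neq0.
  by rewrite !mul0r !addr0 mul1r; exists x => //; exists y, z.
exists a, b; split=> //.
pose M (m n k : int) := L (pt (a * m%:~R) (a * n%:~R) (b * k%:~R)).
have Lint v : L v -> exists m n k, M m n k /\ v = pt (a * m%:~R) (a * n%:~R) (b * k%:~R).
  rewrite [v]pt_eta => h.
  have [m hm] : exists m : int, v 0 0 = a * m%:~R by apply/aP; exists (v 0 1), (v 0 2).
  have [n hn] : exists n : int, v 0 1 = a * n%:~R.
    by apply/aP; exists (v 0 0), (v 0 2); apply: hxy.
  have [k hk] : exists k : int, v 0 2 = b * k%:~R by apply/bP; exists (v 0 0), (v 0 1).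
  by exists m, n, k; rewrite /M -hm -hn -hk.
have LE C : (forall m n k, M m n k <-> C m n k) -> L = int_box a b C.
  move=> MC; apply/seteqP; split=> [v /Lint[m [n [k [/MC Cmnk ->]]]]|]; first by exists m, n, k.
  by move=> _ [m [n [k [/MC Mmnk ->]]]].
have Mcomb m n k m' n' k' i j : M m n k -> M m' n' k' ->
    M (i * m + j * m') (i * n + j * n') (i * k + j * k').
  by move=> h h'; apply: int_combination.
have Mswap m n k : M m n k -> M n m k by apply: hxy.
have M0 : M 0 0 0 by rewrite /M !mulr0 pt0; apply: LA.1.
have [n0 [k0 M1]] : exists n k, M 1 n k.
  have /aP[y [z /[dup] h /Lint[m [n [k [h' e]]]]]] : exists n : int, a = a * n%:~R.
    by exists 1; rewrite mulr1.
  have := congr1 (fun w : 'rV_3 => w 0 0) e; rewrite !ptK => am.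
  suff m1 : m = 1 by exists n, k; rewrite -m1.
  by apply: (@intr_inj R); apply: (mulfI (lt0r_neq0 a0)); rewrite -am mulr1.
have [m1 [n1 M2]] : exists m n, M m n 1.
  have /bP[x [y /[dup] h /Lint[m [n [k [h' e]]]]]] : exists n : int, b = b * n%:~R.
    by exists 1; rewrite mulr1.
  have := congr1 (fun w : 'rV_3 => w 0 2) e; rewrite !ptK => bk.
  suff k1 : k = 1 by exists m, n; rewrite -k1.
  by apply: (@intr_inj R); apply: (mulfI (lt0r_neq0 b0)); rewrite -bk mulr1.
have Mx2 : M 2 0 0.
  by move: M1 => /hx2; rewrite /M; congr (L (pt _ _ _)); ring.
have Mz2 : M 0 0 2.
  by move: M2 => /hz2; rewrite /M; congr (L (pt _ _ _)); ring.
have par m n k m' n' k' : M m n k -> (2 %| m - m')%Z -> (2 %| n - n')%Z ->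
    (2 %| k - k')%Z -> M m' n' k'.
  move=> h /dvdzP[q hq] /dvdzP[r hr] /dvdzP[s hs].
  have h1 := Mcomb _ _ _ _ _ _ 1 (- q) h Mx2.
  have h2 := Mcomb _ _ _ _ _ _ 1 (- r) h1 (Mswap _ _ _ Mx2).
  have := Mcomb _ _ _ _ _ _ 1 (- s) h2 Mz2.
  by congr (M _ _ _); lia.
have add m n k m' n' k' : M m n k -> M m' n' k' -> M (m + m') (n + n') (k + k').
  by move=> h h'; have := Mcomb _ _ _ _ _ _ 1 1 h h'; rewrite !mul1r.
have [M100|N100] := pselect (M 1 0 0).
  have M010 := Mswap _ _ _ M100.
  have M001 : M 0 0 1.
    have := Mcomb _ _ _ _ _ _ 1 (- n1) (Mcomb _ _ _ _ _ _ 1 (- m1) M2 M100) M010.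
    by congr (M _ _ _); lia.
  constructor 1; apply: LE => m n k; split=> // _.
  have := Mcomb _ _ _ _ _ _ 1 k (Mcomb _ _ _ _ _ _ m n M100 M010) M001.
  by congr (M _ _ _); lia.
have [M001|N001] := pselect (M 0 0 1).
  constructor 4; apply: LE => m n k.
  have M110 : M 1 1 0.
    have h := Mcomb _ _ _ _ _ _ 1 (- k0) M1 M001.
    have [n0e|n0o] := boolP (2 %| n0)%Z; last by apply: (par _ _ _ _ _ _ h); lia.
    by case: N100; apply: (par _ _ _ _ _ _ h); lia.
  split=> [h|mn].
    have h0 := Mcomb _ _ _ _ _ _ 1 (- k) h M001.
    apply/negP => mn; apply: N100.
    have [me|mo] := boolP (2 %| m)%Z; last by apply: (par _ _ _ _ _ _ h0); lia.
    by apply: Mswap; apply: (par _ _ _ _ _ _ h0); lia.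
  have h := Mcomb _ _ _ _ _ _ m k M110 M001.
  by apply: (par _ _ _ _ _ _ h); lia.
have [M110|N110] := pselect (M 1 1 0).
  have M101 : M 1 0 1.
    have [me|mo] := boolP (2 %| m1)%Z; have [ne|no] := boolP (2 %| n1)%Z.
    - by case: N001; apply: (par _ _ _ _ _ _ M2); lia.
    - by apply: (par _ _ _ _ _ _ (Mswap _ _ _ M2)); lia.
    - by apply: (par _ _ _ _ _ _ M2); lia.
    - by case: N001; apply: (par _ _ _ _ _ _ (add _ _ _ _ _ _ M2 M110)); lia.
  constructor 2; apply: LE => m n k; split=> [h|mnk]; last first.
    have := Mcomb _ _ _ _ _ _ m n M101 (Mswap _ _ _ M101).
    by move=> /par; apply; lia.
  apply/negPn/negP => mnk; have [ke|ko] := boolP (2 %| k)%Z.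
    have [me|mo] := boolP (2 %| m)%Z.
      by apply: N100; apply: (par _ _ _ _ _ _ (Mswap _ _ _ h)); lia.
    by apply: N100; apply: (par _ _ _ _ _ _ h); lia.
  by apply: N001; apply: (par _ _ _ _ _ _ (Mcomb _ _ _ _ _ _ 1 m h M110)); lia.
have same m n k : M m n k -> (2 %| m - n)%Z.
  move=> h; apply/negPn/negP => mn; apply: N110.
  by apply: (par _ _ _ _ _ _ (add _ _ _ _ _ _ h (Mswap _ _ _ h))); lia.
have M111 : M 1 1 1.
  have := same _ _ _ M1; have [ke|ko] := boolP (2 %| k0)%Z => n0o.
    by case: N110; apply: (par _ _ _ _ _ _ M1); lia.
  by apply: (par _ _ _ _ _ _ M1); lia.
constructor 3; apply: LE => m n k; split=> [h|[mn nk]]; last first.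
  by apply: (par _ _ _ _ _ _ (Mcomb _ _ _ _ _ _ m 0 M111 M0)); lia.
have mn := same _ _ _ h; split=> //; apply/negPn/negP => nk; apply: N001.
by apply: (par _ _ _ _ _ _ (Mcomb _ _ _ _ _ _ 1 n h M111)); lia.
Qed.

(** The vectors of [L] on the [y]-axis and on the [z]-axis correspond under the
    exchange of [y] and [z].  In three of the four square lattices these two
    groups are generated by [s a] and [s b] with the same [s], so each of [a] and
    [b] is an integral multiple of the other.  The fourth square lattice contains
    [(a, a, 0)] but not its image [(a, 0, a)]. *)
Lemma cubic_lattices L : is_lattice_group 3 L ->
    (forall x y z, L (pt x y z) -> L (pt (- x) y z)) ->
    (forall x y z, L (pt x y z) -> L (pt y x z)) ->
    (forall x y z, L (pt x y z) -> L (pt x z y)) ->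
  exists2 a, 0 < a &
    [\/ L = int_box a a (fun _ _ _ => True),
        L = int_box a a (fun m n k => (2 %| m + n + k)%Z) |
        L = int_box a a (fun m n k => (2 %| m - n)%Z /\ (2 %| n - k)%Z)].
Proof.
move=> Llat hx hxy hyz.
have hz x y z : L (pt x y z) -> L (pt x y (- z)) by move=> /hyz/hxy/hx/hxy/hyz.
have [a [b [a0 b0 Lab]]] := square_lattices Llat hx hz hxy.
have a0' := lt0r_neq0 a0; have b0' := lt0r_neq0 b0.
have box C (m n k : int) : L = int_box a b C -> C m n k ->
    exists m' n' k' : int, [/\ C m' n' k', a * m%:~R = a * m'%:~R,
      b * k%:~R = a * n'%:~R & a * n%:~R = b * k'%:~R].
  move=> LC Cmnk; have : L (pt (a * m%:~R) (a * n%:~R) (b * k%:~R)).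
    by rewrite LC; apply/int_boxP.
  move=> /hyz; rewrite LC => -[m' [n' [k' [C' e]]]]; exists m', n', k'; split=> //.
  - by have := congr1 (fun w : 'rV_3 => w 0 0) e; rewrite !ptK.
  - by have := congr1 (fun w : 'rV_3 => w 0 1) e; rewrite !ptK.
  - by have := congr1 (fun w : 'rV_3 => w 0 2) e; rewrite !ptK.
have ab C (s : int) : s != 0 -> L = int_box a b C -> C 0 0 s -> C 0 s 0 ->
    (forall n, C 0 n 0 -> (s %| n)%Z) -> (forall k, C 0 0 k -> (s %| k)%Z) -> a = b.
  rewrite -(intr_eq0 R) => s0 LC Cz Cy Cys Czs.
  have [m [n [k [+ + e1 +]]]] := box _ _ _ _ LC Cz.
  rewrite !mulr0 => + /esym/eqP + /esym/eqP.
  rewrite !mulf_eq0 !intr_eq0 (negPf a0') (negPf b0') /=.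
  move=> + /eqP m0 /eqP k0; rewrite m0 k0 => /Cys/dvdzP[q nq].
  have {nq}bq : b = a * q%:~R.
    by apply: (mulIf s0); rewrite e1 nq intrM mulrA.
  have [m' [n' [k' [+ + + e2]]]] := box _ _ _ _ LC Cy.
  rewrite !mulr0 => + /esym/eqP + /esym/eqP.
  rewrite !mulf_eq0 !intr_eq0 (negPf a0') /=.
  move=> + /eqP m0' /eqP n0'; rewrite m0' n0' => /Czs/dvdzP[r kr].
  have {kr}ar : a = b * r%:~R.
    by apply: (mulIf s0); rewrite e2 kr intrM mulrA.
  have qr : q * r = 1.
    apply: (@intr_inj R); apply: (mulfI a0').
    by rewrite mulr1 {2}ar {1}bq intrM mulrA.
  have q0 : 0 < q by rewrite -(ltr0z R) -(pmulr_rgt0 _ a0) -bq.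
  have r0 : 0 < r by rewrite -(pmulr_rgt0 _ q0) qr.
  by rewrite bq (_ : q = 1) ?mulr1 //; nia.
exists a => //; case: Lab => LC.
- by constructor 1; rewrite {2}(ab _ 1 isT LC).
- by constructor 2; rewrite {2}(ab _ 2 isT LC) // => n; lia.
- by constructor 3; rewrite {2}(ab _ 2 isT LC) // => n; lia.
- have [m [n [k [mn /(mulfI a0')/intr_inj m1 + _]]]] := box _ 1 1 0 LC isT.
  rewrite mulr0 => /esym/eqP; rewrite mulf_eq0 intr_eq0 (negPf a0') => /eqP n0.
  by move: mn; rewrite -m1 n0.
Qed.

(** Coordinates refer to the basis [u_1, u_2, e_3]; in it the symmetries assumed
    here are the rotation by 120 degrees about the [z]-axis and, for the planar
    part only, the reflection fixing [u_1].  The scale [a] is chosen so that [3a] generates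
    the lattice vectors on the line of [u_1]; then [3 (x + y)] is a multiple of
    [3a] for every lattice vector, and applying the rotation gives that [x] and
    [y] are multiples of [a]. *)
Lemma hexagonal_lattices L : is_lattice_group 3 L ->
    (forall x y z, L (pt x y z) -> L (pt (- x - y) x z)) ->
    (forall x y, L (pt x y 0) -> L (pt (x + y) (- y) 0)) ->
  exists a b, [/\ 0 < a, 0 < b &
       [\/ L = int_box a b (fun m n _ => (3 %| m)%Z /\ (3 %| n)%Z),
           L = int_box a b (fun m n k => (3 %| m - k)%Z /\ (3 %| n - k)%Z) |
           L = int_box a b (fun m n k => (3 %| m + k)%Z /\ (3 %| n + k)%Z)]
    \/ [\/ L = int_box a b (fun m n _ => (3 %| m - n)%Z),
           L = int_box a b (fun m n k => (3 %| m - n - k)%Z) |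
           L = int_box a b (fun m n k => (3 %| m - n + k)%Z)]].
Proof.
move=> Llat hrot hflat; have LA := lattice_additive Llat.
have hz3 x y z : L (pt x y z) -> L (pt 0 0 (3%:~R * z)).
  move=> /[dup] h /hrot/[dup] h1 /hrot h2.
  have := additiveD LA (additiveD LA h h1) h2; rewrite !ptD.
  by congr (L (pt _ _ _)); ring.
have hdiff x y z : L (pt x y z) -> L (pt (2 * x + y) (y - x) 0).
  move=> h; have /(LA.2 _ _ h) := hrot _ _ _ h; rewrite ptB.
  by congr (L (pt _ _ _)); ring.
have hflat2 x y : L (pt x y 0) -> L (pt (2 * x + y) 0 0).
  move=> h; have := additiveD LA h (hflat _ _ h); rewrite ptD.
  by congr (L (pt _ _ _)); ring.
have hx3 x y z : L (pt x y z) -> L (pt (3 * (x + y)) 0 0).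
  move=> /hdiff/hflat2; by congr (L (pt _ _ _)); ring.
have [b b0 bP] := heights_cyclic (s := 3) Llat isT hz3.
have [a a0 aP] : exists2 a, 0 < a &
    forall x, L (pt (3 * x) 0 0) <-> exists n : int, x = a * n%:~R.
  have [c hc] := lattice_xline Llat.
  apply: (@cyclic_subgroup _ [set x | L (pt (3 * x) 0 0)] (c / 3)).
  - split=> [|x x' h h'] /=; first by rewrite mulr0 pt0; apply: LA.1.
    by rewrite mulrBr; have := LA.2 _ _ h h'; rewrite ptB !subr0.
  - by move=> x /hc[n hn]; exists n; lra.
  have [|x [y [z [/hx3 Lz]]]] := lattice_not_in_plane (a := 1) (b := 1) (c := 0) Llat.
    by apply: (pt_neq0 (i := 0)); rewrite ptK oner_neq0.
  by rewrite !mul0r !addr0 !mul1r; exists (x + y).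
exists a, b; split=> //.
pose M (m n k : int) := L (pt (a * m%:~R) (a * n%:~R) (b * k%:~R)).
have Lint v : L v -> exists m n k, M m n k /\ v = pt (a * m%:~R) (a * n%:~R) (b * k%:~R).
  rewrite [v]pt_eta => h.
  have [s hs] : exists m : int, v 0 0 + v 0 1 = a * m%:~R by apply/aP; apply: hx3 h.
  have [n hn] : exists n : int, - v 0 1 = a * n%:~R.
    by apply/aP; have := hx3 _ _ _ (hrot _ _ _ h); congr (L (pt _ _ _)); ring.
  have [k hk] : exists k : int, v 0 2 = b * k%:~R by apply/bP; exists (v 0 0), (v 0 1).
  exists (s + n), (- n), k; rewrite /M -hk.
  have -> : a * (s + n)%:~R = v 0 0 by rewrite intrD mulrDr -hs -hn; ring.
  by have -> : a * (- n)%:~R = v 0 1 by rewrite intrN mulrN -hn opprK.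
have LE C : (forall m n k, M m n k <-> C m n k) -> L = int_box a b C.
  move=> MC; apply/seteqP; split=> [v /Lint[m [n [k [/MC Cmnk ->]]]]|]; first by exists m, n, k.
  by move=> _ [m [n [k [/MC Mmnk ->]]]].
have Mcomb m n k m' n' k' i j : M m n k -> M m' n' k' ->
    M (i * m + j * m') (i * n + j * n') (i * k + j * k').
  by move=> h h'; apply: int_combination.
have Mrot m n k : M m n k -> M (- m - n) m k.
  by move=> /hrot; rewrite /M; congr (L (pt _ _ _)); ring.
have Mdiff m n k : M m n k -> M (2 * m + n) (n - m) 0.
  by move=> /hdiff; rewrite /M; congr (L (pt _ _ _)); ring.
have Mflat m n : M m n 0 -> (3 %| m - n)%Z.
  rewrite /M mulr0 => /hflat2; move: (aP (a * (2 * m + n)%:~R / 3)) => -[+ _].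
  rewrite mulrC divfK ?pnatr_eq0 // => ha h; have [|q] := ha _.
    by move: h; congr (L (pt _ _ _)); ring.
  move=> hq; suff : 2 * m + n = 3 * q by lia.
  apply: (@intr_inj R); apply: (mulfI (lt0r_neq0 a0)); rewrite intrM; lra.
have M300 : M 3 0 0.
  have /aP : exists n : int, a = a * n%:~R by exists 1; rewrite mulr1.
  by rewrite /M; congr (L (pt _ _ _)); ring.
have M030 : M 0 3 0.
  by have := Mcomb _ _ _ _ _ _ 1 1 (Mrot _ _ _ M300) M300.
have [p [q Mpq]] : exists m n, M m n 1.
  have /bP[x [y /[dup] h /Lint[m [n [k [h' e]]]]]] : exists n : int, b = b * n%:~R.
    by exists 1; rewrite mulr1.
  have := congr1 (fun w : 'rV_3 => w 0 2) e; rewrite !ptK => bk.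
  suff k1 : k = 1 by exists m, n; rewrite -k1.
  by apply: (@intr_inj R); apply: (mulfI (lt0r_neq0 b0)); rewrite -bk mulr1.
have mod3 m n k m' n' k' : M m n k -> (3 %| m - m')%Z -> (3 %| n - n')%Z ->
    k = k' -> M m' n' k'.
  move=> h /dvdzP[r hr] /dvdzP[s hs] <-.
  have h1 := Mcomb _ _ _ _ _ _ 1 (- r) h M300.
  have := Mcomb _ _ _ _ _ _ 1 (- s) h1 M030.
  by congr (M _ _ _); lia.
have layer u v m n k : M u v 1 -> (M m n k <-> M (m - k * u) (n - k * v) 0).
  move=> h; split=> h'.
    by have := Mcomb _ _ _ _ _ _ 1 (- k) h' h; congr (M _ _ _); lia.
  by have := Mcomb _ _ _ _ _ _ 1 k h' h; congr (M _ _ _); lia.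
(* [M 1 1 0] says that the planar part is the finer of the two lattices between
   [3 Z^2] and the vectors with congruent coordinates modulo 3. *)
have [M110|N110] := pselect (M 1 1 0); [right|left].
  have M0 m n : M m n 0 <-> (3 %| m - n)%Z.
    split=> [/Mflat//|mn]; by apply: (mod3 _ _ _ _ _ _ (Mcomb _ _ _ _ _ _ n 0 M110 M110)); lia.
  have Mpq0 := Mcomb _ _ _ _ _ _ 1 (- q) Mpq M110.
  have [d0|d0] := boolP (3 %| p - q)%Z.
    have h : M 0 0 1 by apply: (mod3 _ _ _ _ _ _ Mpq0); lia.
    by constructor 1; apply: LE => m n k; rewrite (layer _ _ _ _ _ h) M0 !mulr0 !subr0.
  have [d1|d1] := boolP (3 %| p - q - 1)%Z.
    have h : M 1 0 1 by apply: (mod3 _ _ _ _ _ _ Mpq0); lia.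
    constructor 2; apply: LE => m n k; rewrite (layer _ _ _ _ _ h) M0.
    by split; lia.
  have h : M (-1) 0 1 by apply: (mod3 _ _ _ _ _ _ Mpq0); lia.
  constructor 3; apply: LE => m n k; rewrite (layer _ _ _ _ _ h) M0.
  by split; lia.
have M0 m n : M m n 0 <-> (3 %| m)%Z /\ (3 %| n)%Z.
  split=> [h|[hm hn]]; last first.
    by apply: (mod3 _ _ _ _ _ _ (Mcomb _ _ _ _ _ _ 0 0 M300 M300)); lia.
  have mn := Mflat _ _ h; have [hm|hm] := boolP (3 %| m)%Z; first by split=> //; lia.
  case: N110; have [hm1|hm1] := boolP (3 %| m - 1)%Z.
    by apply: (mod3 _ _ _ _ _ _ h); lia.
  by apply: (mod3 _ _ _ _ _ _ (Mcomb _ _ _ _ _ _ (-1) 0 h h)); lia.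
(* Over the coarser planar part, the difference between a vector of the first
   layer and its rotated image restricts that vector modulo 3. *)
have [pq1 pq2] : (3 %| 2 * p + q)%Z /\ (3 %| q - p)%Z by apply/M0; apply: Mdiff Mpq.
have [d0|d0] := boolP (3 %| p)%Z.
  have h : M 0 0 1 by apply: (mod3 _ _ _ _ _ _ Mpq); lia.
  by constructor 1; apply: LE => m n k; rewrite (layer _ _ _ _ _ h) M0 !mulr0 !subr0.
have [d1|d1] := boolP (3 %| p - 1)%Z.
  have h : M 1 1 1 by apply: (mod3 _ _ _ _ _ _ Mpq); lia.
  constructor 2; apply: LE => m n k; rewrite (layer _ _ _ _ _ h) M0.
  by rewrite !mulr1.
have h : M (-1) (-1) 1 by apply: (mod3 _ _ _ _ _ _ Mpq); lia.
constructor 3; apply: LE => m n k; rewrite (layer _ _ _ _ _ h) M0.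
by rewrite !mulrN1 !opprK.
Qed.

(** The triangular lattice with parameter [3a], seen on the scale [a]. *)
Lemma int_box_triple a b :
  int_box a b (fun m n _ => (3 %| m)%Z /\ (3 %| n)%Z) =
  int_box (a * 3) b (fun _ _ _ => True).
Proof.
apply/seteqP; split=> [v [_ [_ [k [[/dvdzP[m ->] /dvdzP[n ->]] ->]]]]|v [m [n [k [_ ->]]]]].
  by exists m, n, k; split=> //; congr pt; rewrite intrM; ring.
exists (m * 3), (n * 3), k; split; first by lia.
by congr pt; rewrite intrM; ring.
Qed.

(** Used to exclude a family: one vector of the family and its image under a
    symmetry whose integral coordinates violate [C]. *)
Lemma int_box_move L a b C (f : R -> R -> R -> 'rV[R]_3) (m n k m' n' k' : int) :
    0 < a -> 0 < b -> L = int_box a b C ->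
    (forall x y z, L (pt x y z) -> L (f x y z)) -> C m n k ->
    f (a * m%:~R) (a * n%:~R) (b * k%:~R) =
      pt (a * m'%:~R) (a * n'%:~R) (b * k'%:~R) ->
  C m' n' k'.
Proof.
move=> /lt0r_neq0 a0 /lt0r_neq0 b0 LC hf Cmnk e; apply/(int_boxP _ _ _ _ a0 b0).
by rewrite -LC -e; apply: hf; rewrite LC; apply/int_boxP.
Qed.

Lemma hexagonal_lattices_mirror L : is_lattice_group 3 L ->
    (forall x y z, L (pt x y z) -> L (pt (- x - y) x z)) ->
    (forall x y z, L (pt x y z) -> L (pt (x + y) (- y) z)) ->
  exists a b, [/\ 0 < a, 0 < b &
    [\/ L = int_box a b (fun _ _ _ => True),
        L = int_box a b (fun m n _ => (3 %| m - n)%Z),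
        L = int_box a b (fun m n k => (3 %| m - n - k)%Z) |
        L = int_box a b (fun m n k => (3 %| m - n + k)%Z)]].
Proof.
move=> Llat hrot hm; have [|a [b [a0 b0 cases]]] := hexagonal_lattices Llat hrot.
  by move=> x y /hm.
case: cases => -[] LC.
- by exists (a * 3), b; split; [lra| |constructor 1; rewrite LC int_box_triple].
- have [|//] := int_box_move (m' := 2) (n' := -1) (k' := 1) a0 b0 LC hm
    (conj isT isT : (3 %| 1 - 1)%Z /\ (3 %| 1 - 1)%Z).
  by congr pt; ring.
- have [|//] := int_box_move (m' := -2) (n' := 1) (k' := 1) a0 b0 LC hm
    (conj isT isT : (3 %| -1 + 1)%Z /\ (3 %| -1 + 1)%Z).
  by congr pt; ring.
- by exists a, b; split=> //; constructor 2.
- by exists a, b; split=> //; constructor 3.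
- by exists a, b; split=> //; constructor 4.
Qed.

Lemma hexagonal_lattices_swap L : is_lattice_group 3 L ->
    (forall x y z, L (pt x y z) -> L (pt (- x - y) x z)) ->
    (forall x y z, L (pt x y z) -> L (pt y x z)) ->
  exists a b, [/\ 0 < a, 0 < b &
    [\/ L = int_box a b (fun _ _ _ => True),
        L = int_box a b (fun m n _ => (3 %| m - n)%Z),
        L = int_box a b (fun m n k => (3 %| m - k)%Z /\ (3 %| n - k)%Z) |
        L = int_box a b (fun m n k => (3 %| m + k)%Z /\ (3 %| n + k)%Z)]].
Proof.
move=> Llat hrot hs; have [|a [b [a0 b0 cases]]] := hexagonal_lattices Llat hrot.
  move=> x y /hs/hrot/additiveN => /(_ (lattice_additive Llat)).
  by rewrite -sub0r -pt0 ptB; congr (L (pt _ _ _)); ring.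
case: cases => -[] LC.
- by exists (a * 3), b; split; [lra| |constructor 1; rewrite LC int_box_triple].
- by exists a, b; split=> //; constructor 3.
- by exists a, b; split=> //; constructor 4.
- by exists a, b; split=> //; constructor 2.
- have // := int_box_move (m' := 0) (n' := 1) (k' := 1) a0 b0 LC hs
    (isT : (3 %| 1 - 0 - 1)%Z) erefl.
- have // := int_box_move (m' := 0) (n' := 1) (k' := -1) a0 b0 LC hs
    (isT : (3 %| 1 - 0 + -1)%Z) erefl.
Qed.

Lemma hexagonal_lattices_mirror_swap L : is_lattice_group 3 L ->
    (forall x y z, L (pt x y z) -> L (pt (- x - y) x z)) ->
    (forall x y z, L (pt x y z) -> L (pt (x + y) (- y) z)) ->
    (forall x y z, L (pt x y z) -> L (pt y x z)) ->
  exists a b, [/\ 0 < a, 0 < b &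
    L = int_box a b (fun _ _ _ => True) \/
    L = int_box a b (fun m n _ => (3 %| m - n)%Z)].
Proof.
move=> Llat hrot hm hs; have [a [b [a0 b0 cases]]] := hexagonal_lattices_mirror Llat hrot hm.
exists a, b; split=> //; case: cases => LC; [by left|by right| |].
- by have := int_box_move (m' := 0) (n' := 1) (k' := 1) a0 b0 LC hs
    (isT : (3 %| 1 - 0 - 1)%Z) erefl.
- by have := int_box_move (m' := 0) (n' := 1) (k' := -1) a0 b0 LC hs
    (isT : (3 %| 1 - 0 + -1)%Z) erefl.
Qed.
End Classification.

(** * From the torus to the lattice *)

Section Torus.
Variable R : realType.
Implicit Types (L : set 'rV[R]_3) (P : generators R) (f g : 'rV[R]_3 -> 'rV[R]_3).

(** Invariance under the linear part of [f], phrased with differences so that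
    translation parts drop out and the property is stable under composition. *)
Definition preserves L f : Prop := forall p q, L (p - q) -> L (f p - f q).

Definition preserved_by L P : Prop :=
  [/\ preserves L (gen0 P), preserves L (gen1 P) & preserves L (gen2 P)].

Lemma induces_preserves L f S : additive_group L -> @induces R L f S -> preserves L f.
Proof.
move=> LA [_ fS] p q Lpq.
have pq : torus_proj L p = torus_proj L q.
  apply: eq_exist; apply/seteqP; split=> _ [l Ll <-].
    by exists (p - q + l); [apply: additiveD|rewrite addrA subrKC].
  exists (q - p + l); last by rewrite addrA subrKC.
  by apply: additiveD => //; rewrite -opprB; apply: additiveN.
have /(congr1 sval) /= e : torus_proj L (f p) = torus_proj L (f q) by rewrite !fS pq.
have : coset L (f p) (f p) by exists 0; [exact: LA.1|rewrite addr0].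
by rewrite e => -[l Ll <-]; rewrite addrC addKr.
Qed.

Lemma realization_preserved L P : additive_group L ->
  symmetric_toroidal_realization L P -> preserved_by L P.
Proof.
move=> LA [_ _ _ [S0 [S1 [S2 [h0 h1 h2 _]]]]].
by split; apply: induces_preserves => //; [exact: h0|exact: h1|exact: h2].
Qed.

(** [R_0] is recovered from the Petrial as [(R_0 R_2) R_2]. *)
Lemma preserved_by_petrials L (A : set (generators R)) P :
    (forall Q, A Q -> cancel (gen2 Q) (gen2 Q)) ->
    with_petrials A P -> preserved_by L P ->
  exists2 Q, A Q & preserved_by L Q.
Proof.
move=> inv2 [AP|[Q AQ <-]]; first by exists P.
move=> [/= h0 h1 h2]; exists Q => //; split=> // p q Lpq.
by rewrite -(inv2 _ AQ (gen0 Q p)) -(inv2 _ AQ (gen0 Q q)); apply/h2/h0.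
Qed.

(** [g] is meant as a simplified formula for the linear part of [f]. *)
Lemma preserves_linear L (f g : R -> R -> R -> 'rV[R]_3) :
    preserves L (coord_map f) -> (forall x y z, f x y z - f 0 0 0 = g x y z) ->
  forall x y z, L (pt x y z) -> L (g x y z).
Proof.
move=> hf fg x y z; rewrite -[pt x y z]subr0 -pt0 => /hf.
by rewrite /coord_map !ptK fg.
Qed.

Lemma additive_pt_neg L : additive_group L -> forall x y z : R,
  L (pt x y z) -> L (pt (- x) (- y) (- z)).
Proof.
by move=> LA x y z /(additiveN LA); rewrite -sub0r -pt0 ptB !sub0r.
Qed.

End Torus.

Ltac linear_part h :=
  by apply: (preserves_linear h) => x y z; rewrite ptB; congr pt; ring.

(** * Symmetries of the special groups *)

Section Symmetries.
Variables (R : realType) (L : set 'rV[R]_3).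
Hypothesis LA : additive_group L.

(** Together with the central inversion, the linear parts of the three generators
    generate the full octahedral group in all twelve cases; the proof exhibits
    words for the three reflections. *)
Lemma pure_symmetries P : pure_apeirohedra P -> preserved_by L P ->
  [/\ forall x y z, L (pt x y z) -> L (pt (- x) y z),
      forall x y z, L (pt x y z) -> L (pt y x z) &
      forall x y z, L (pt x y z) -> L (pt x z y)].
Proof.
have neg := additive_pt_neg LA.
move=> [[[[[[[[[[[->|->]|->]|->]|->]|->]|->]|->]|->]|->]|->]|->] [h0 h1 h2].
- have r0 : forall x y z, L (pt x y z) -> L (pt (- x) y z) by linear_part h0.
  have r1 : forall x y z, L (pt x y z) -> L (pt y x (- z)) by linear_part h1.
  have r2 : forall x y z, L (pt x y z) -> L (pt x z y) by linear_part h2.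
  by split=> x y z; [move=> /r0|move=> /r0/r1/r0/neg|move=> /r2]; rewrite ?opprK.
- have r0 : forall x y z, L (pt x y z) -> L (pt x z y) by linear_part h0.
  have r1 : forall x y z, L (pt x y z) -> L (pt y x (- z)) by linear_part h1.
  have r2 : forall x y z, L (pt x y z) -> L (pt (- x) y z) by linear_part h2.
  by split=> x y z; [move=> /r2|move=> /r2/r1/r2/neg|move=> /r0]; rewrite ?opprK.
- have r0 : forall x y z, L (pt x y z) -> L (pt x (- z) (- y)) by linear_part h0.
  have r1 : forall x y z, L (pt x y z) -> L (pt y x (- z)) by linear_part h1.
  have r2 : forall x y z, L (pt x y z) -> L (pt x z y) by linear_part h2.
  by split=> x y z; [move=> /r0/r2/neg|move=> /r0/r1/r2/r1/r0|move=> /r2]; rewrite ?opprK.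
- have r0 : forall x y z, L (pt x y z) -> L (pt (- x) z y) by linear_part h0.
  have r1 : forall x y z, L (pt x y z) -> L (pt y x (- z)) by linear_part h1.
  have r2 : forall x y z, L (pt x y z) -> L (pt x z y) by linear_part h2.
  by split=> x y z; [move=> /r0/r2|move=> /r0/r1/r2/r1/r0|move=> /r2]; rewrite ?opprK.
- have r0 : forall x y z, L (pt x y z) -> L (pt (- x) z y) by linear_part h0.
  have r1 : forall x y z, L (pt x y z) -> L (pt y x (- z)) by linear_part h1.
  have r2 : forall x y z, L (pt x y z) -> L (pt (- x) y z) by linear_part h2.
  by split=> x y z; [move=> /r2|move=> /r2/r1/r2/neg|move=> /r0/r2]; rewrite ?opprK.
- have r0 : forall x y z, L (pt x y z) -> L (pt x (- y) (- z)) by linear_part h0.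
  have r1 : forall x y z, L (pt x y z) -> L (pt y x (- z)) by linear_part h1.
  have r2 : forall x y z, L (pt x y z) -> L (pt x z y) by linear_part h2.
  by split=> x y z; [move=> /r0/neg|move=> /r0/r1/r0/neg|move=> /r2]; rewrite ?opprK.
- have r0 : forall x y z, L (pt x y z) -> L (pt (- y) (- x) (- z)) by linear_part h0.
  have r1 : forall x y z, L (pt x y z) -> L (pt x z y) by linear_part h1.
  have r2 : forall x y z, L (pt x y z) -> L (pt y x (- z)) by linear_part h2.
  by split=> x y z; [move=> /r0/r1/r2/r1/r0/r1|move=> /r0/neg|move=> /r1]; rewrite ?opprK.
- have r0 : forall x y z, L (pt x y z) -> L (pt (- x) (- y) z) by linear_part h0.
  have r1 : forall x y z, L (pt x y z) -> L (pt x z y) by linear_part h1.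
  have r2 : forall x y z, L (pt x y z) -> L (pt y x (- z)) by linear_part h2.
  by split=> x y z; [move=> /r0/r1/r0/r1/neg|move=> /r0/r2/neg|move=> /r1]; rewrite ?opprK.
- have r0 : forall x y z, L (pt x y z) -> L (pt (- y) (- x) (- z)) by linear_part h0.
  have r1 : forall x y z, L (pt x y z) -> L (pt z (- y) x) by linear_part h1.
  have r2 : forall x y z, L (pt x y z) -> L (pt y x (- z)) by linear_part h2.
  by split=> x y z; [move=> /r1/r0/r2/r1/neg|move=> /r0/neg|move=> /r1/r2/r1/neg]; rewrite ?opprK.
- have r0 : forall x y z, L (pt x y z) -> L (pt (- x) (- y) z) by linear_part h0.
  have r1 : forall x y z, L (pt x y z) -> L (pt z (- y) x) by linear_part h1.
  have r2 : forall x y z, L (pt x y z) -> L (pt y x (- z)) by linear_part h2.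
  by split=> x y z; [move=> /r1/r0/r1/neg|move=> /r0/r2/neg|move=> /r1/r2/r1/neg]; rewrite ?opprK.
- have r0 : forall x y z, L (pt x y z) -> L (pt y x (- z)) by linear_part h0.
  have r1 : forall x y z, L (pt x y z) -> L (pt x z y) by linear_part h1.
  have r2 : forall x y z, L (pt x y z) -> L (pt (- x) (- y) z) by linear_part h2.
  by split=> x y z; [move=> /r1/r2/r1/r2/neg|move=> /r0/r2/neg|move=> /r1]; rewrite ?opprK.
- have r0 : forall x y z, L (pt x y z) -> L (pt y x (- z)) by linear_part h0.
  have r1 : forall x y z, L (pt x y z) -> L (pt (- x) z y) by linear_part h1.
  have r2 : forall x y z, L (pt x y z) -> L (pt (- x) (- y) z) by linear_part h2.
  by split=> x y z; [move=> /r1/r2/r1/r2/neg|move=> /r0/r2/neg|move=> /r2/r1/r2/neg]; rewrite ?opprK.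
Qed.

Lemma square_symmetries alpha P :
    with_petrials [set P44; P44_segment alpha; P44_apeirogon alpha] P ->
    preserved_by L P ->
  [/\ forall x y z, L (pt x y z) -> L (pt (- x) y z),
      forall x y z, L (pt x y z) -> L (pt x y (- z)) &
      forall x y z, L (pt x y z) -> L (pt y x z)].
Proof.
have neg := additive_pt_neg LA.
move=> AP LP; have [|Q AQ [h0 h1 h2]] := preserved_by_petrials _ AP LP.
  move=> Q [[->|->]|->] p /=; rewrite [p]pt_eta /coord_map !ptK; congr pt; ring.
case: AQ h0 h1 h2 => [[->|->]|->] h0 h1 h2.
- have r0 : forall x y z, L (pt x y z) -> L (pt (- x) y z) by linear_part h0.
  have r1 : forall x y z, L (pt x y z) -> L (pt y x z) by linear_part h1.
  have r2 : forall x y z, L (pt x y z) -> L (pt x (- y) z) by linear_part h2.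
  by split=> // x y z /r0/r2/neg; rewrite !opprK.
- have r0 : forall x y z, L (pt x y z) -> L (pt (- x) y (- z)) by linear_part h0.
  have r1 : forall x y z, L (pt x y z) -> L (pt y x z) by linear_part h1.
  have r2 : forall x y z, L (pt x y z) -> L (pt x (- y) z) by linear_part h2.
  have hx : forall x y z, L (pt x y z) -> L (pt (- x) y z) by move=> x y z /r1/r2/r1.
  by split=> // x y z /r0/hx; rewrite opprK.
- have r0 : forall x y z, L (pt x y z) -> L (pt (- x) y (- z)) by linear_part h0.
  have r1 : forall x y z, L (pt x y z) -> L (pt y x (- z)) by linear_part h1.
  have r2 : forall x y z, L (pt x y z) -> L (pt x (- y) z) by linear_part h2.
  have hx : forall x y z, L (pt x y z) -> L (pt (- x) y z).
    by move=> x y z /r1/r2/r1; rewrite opprK.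
  have hz : forall x y z, L (pt x y z) -> L (pt x y (- z)).
    by move=> x y z /r0/hx; rewrite opprK.
  by split=> // x y z /r1/hz; rewrite opprK.
Qed.

End Symmetries.

(** * Hexagonal coordinates and the lattices of the conclusion *)

Section HexagonalBasis.
Variable R : realType.
Implicit Types (L : set 'rV[R]_3) (P : generators R) (a b x y z : R).

(** Acting on the right, this takes coordinates in the basis [u_1, u_2, e_3] to
    Cartesian ones. *)
Definition hexmx : 'M[R]_3 := \matrix_i nth 0 [:: u1; u2; e3] i.

Lemma hexmxE x y z :
  pt x y z *m hexmx = pt (x + y / 2) (sqrt3 R / 2 * y) z.
Proof.
rewrite pt_mulmx !rowK /= /u1 /u2 /e1 /e2 /e3 !(ptZ, ptD).
by congr pt; ring.
Qed.

Lemma sqrt3_sqr : sqrt3 R * sqrt3 R = 3.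
Proof. by rewrite -expr2 sqr_sqrtr // ler0n. Qed.

Lemma hexmx_unit : hexmx \in unitmx.
Proof.
have s0 : sqrt3 R != 0.
  by apply/eqP => s0; have := sqrt3_sqr; rewrite s0 mul0r => /esym/eqP; rewrite pnatr_eq0.
rewrite -row_free_unit; apply/inj_row_free => v.
rewrite [v]pt_eta hexmxE -pt0 => e.
have H i := congr1 (fun w : 'rV_3 => w 0 i) e.
move: (H 0) (H 1) (H 2); rewrite !ptK => h0 /eqP h1 h2.
have y0 : v 0 1 = 0.
  by move: h1; rewrite !mulf_eq0 (negPf s0) invr_eq0 pnatr_eq0 => /eqP.
by move: h0; rewrite y0 mul0r addr0 => ->; rewrite h2.
Qed.

Lemma hexagonal_linear L (f g : R -> R -> R -> 'rV[R]_3) :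
    preserves L (coord_map f) ->
    (forall x y z, f (x + y / 2) (sqrt3 R / 2 * y) z - f 0 0 0 = g x y z *m hexmx) ->
  forall x y z, lattice_map L (invmx hexmx) (pt x y z) ->
    lattice_map L (invmx hexmx) (g x y z).
Proof.
move=> hf fg x y z /(lattice_mapP _ _ hexmx_unit); rewrite hexmxE => h.
apply/(lattice_mapP _ _ hexmx_unit); rewrite -fg.
exact: (preserves_linear (g := fun x y z => f x y z - f 0 0 0) hf _ h).
Qed.

Lemma lattice_map_int_box L a b C : 0 < a -> 0 < b ->
  L = int_box a b C -> lattice_map L (invmx (diag_aab a b)) = int_box 1 1 C.
Proof.
move=> /lt0r_neq0 a0 /lt0r_neq0 b0 ->; have Du := diag_aab_unit a0 b0.
apply/seteqP; split=> v.
  by move=> /(lattice_mapP _ _ Du)/(int_box_mulmx _ _ a0 b0).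
by move=> /(int_box_mulmx _ _ a0 b0) h; apply/(lattice_mapP _ _ Du).
Qed.

(** The scaling by [diag(a, a, b)] commutes with the change of basis, so it can be
    removed in hexagonal coordinates. *)
Lemma hexagonal_int_box L a b C : 0 < a -> 0 < b ->
    lattice_map L (invmx hexmx) = int_box a b C ->
  lattice_map L (invmx (diag_aab a b)) = lattice_map (int_box 1 1 C) hexmx.
Proof.
move=> /lt0r_neq0 a0 /lt0r_neq0 b0 LC; have Du := diag_aab_unit a0 b0.
have comm (w : 'rV[R]_3) : w *m hexmx *m diag_aab a b = w *m diag_aab a b *m hexmx.
  by rewrite [w]pt_eta hexmxE !pt_diag hexmxE; congr pt; ring.
have key (w : 'rV[R]_3) : L (w *m hexmx *m diag_aab a b) <-> int_box 1 1 C w.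
  rewrite comm; split.
    by move=> /(lattice_mapP _ _ hexmx_unit); rewrite LC => /(int_box_mulmx _ _ a0 b0).
  move=> /(int_box_mulmx _ _ a0 b0); rewrite -LC.
  by move=> /(lattice_mapP _ _ hexmx_unit).
apply/seteqP; split=> v.
  move=> /(lattice_mapP _ _ Du) h; exists (v *m invmx hexmx); last exact: mulmxKV hexmx_unit _.
  by apply/key; rewrite mulmxKV ?hexmx_unit.
by move=> [w /key h <-]; apply/(lattice_mapP _ _ Du).
Qed.

Lemma hexagonal_adjoin (p q p' q' i j : int) :
  adjoin (span_int [set pt p%:~R q%:~R 0 *m hexmx; pt p'%:~R q'%:~R 0 *m hexmx])
    (pt i%:~R j%:~R 1 *m hexmx) =
  lattice_map (int_box 1 1 (fun m n k =>
    exists r s : int, m = r * p + s * p' + k * i /\ n = r * q + s * q' + k * j)) hexmx.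
Proof.
have comb (r s k : int) : r%:~R *: (pt p%:~R q%:~R 0 *m hexmx) +
    s%:~R *: (pt p'%:~R q'%:~R 0 *m hexmx) + k%:~R *: (pt i%:~R j%:~R 1 *m hexmx) =
  pt (1 * (r * p + s * p' + k * i)%:~R) (1 * (r * q + s * q' + k * j)%:~R)
     (1 * k%:~R) *m hexmx.
  rewrite !scalemxAl -!mulmxDl !ptZ !ptD; congr (pt _ _ _ *m _); rewrite ?intrD ?intrM; ring.
rewrite adjoin_span2; apply/seteqP; split.
  move=> _ [r [s [k ->]]]; rewrite comb; eexists; last reflexivity.
  by do 3!eexists; split; last reflexivity; exists r, s.
by move=> _ [_ [_ [_ [k [[r [s [-> ->]]] ->]]]] <-]; exists r, s, k; rewrite comb.
Qed.

Lemma hexagonal_adjoin_eq (g1 g2 t : 'rV[R]_3) (p q p' q' i j : int) C :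
    g1 = pt p%:~R q%:~R 0 *m hexmx -> g2 = pt p'%:~R q'%:~R 0 *m hexmx ->
    t = pt i%:~R j%:~R 1 *m hexmx ->
    (forall m n k, C m n k <-> exists r s : int,
      m = r * p + s * p' + k * i /\ n = r * q + s * q' + k * j) ->
  lattice_map (int_box 1 1 C) hexmx = adjoin (span_int [set g1; g2]) t.
Proof. by move=> -> -> -> /eq_int_box ->; rewrite hexagonal_adjoin. Qed.

Ltac hex_vectors := rewrite hexmxE /u1 /u2 /e1 /e2 /e3 ?(ptZ, ptD, ptB);
  congr pt; field.

Lemma hexagonal_10_e3 :
  lattice_map (int_box 1 1 (fun _ _ _ => True)) hexmx = adjoin Lambda36_10 e3.
Proof.
apply: (@hexagonal_adjoin_eq _ _ _ 1 0 0 1 0 0); try by hex_vectors.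
by move=> m n k; split=> // _; exists m, n; lia.
Qed.

Lemma hexagonal_11_e3 :
  lattice_map (int_box 1 1 (fun m n _ => (3 %| m - n)%Z)) hexmx = adjoin Lambda36_11 e3.
Proof.
apply: (@hexagonal_adjoin_eq _ _ _ 1 1 2 (-1) 0 0); try by hex_vectors.
move=> m n k; split=> [/dvdzP[q hq]|[r [s [-> ->]]]]; last by lia.
by exists (m - 2 * q), q; lia.
Qed.

Lemma hexagonal_11_u1 :
  lattice_map (int_box 1 1 (fun m n k => (3 %| m - n - k)%Z)) hexmx =
  adjoin Lambda36_11 (u1 + e3).
Proof.
apply: (@hexagonal_adjoin_eq _ _ _ 1 1 2 (-1) 1 0); try by hex_vectors.
move=> m n k; split=> [/dvdzP[q hq]|[r [s [-> ->]]]]; last by lia.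
by exists (n + q), q; lia.
Qed.

Lemma hexagonal_11_u2 :
  lattice_map (int_box 1 1 (fun m n k => (3 %| m - n + k)%Z)) hexmx =
  adjoin Lambda36_11 (u2 + e3).
Proof.
apply: (@hexagonal_adjoin_eq _ _ _ 1 1 2 (-1) 0 1); try by hex_vectors.
move=> m n k; split=> [/dvdzP[q hq]|[r [s [-> ->]]]]; last by lia.
by exists (m - 2 * q), q; lia.
Qed.

Lemma hexagonal_30_plus :
  lattice_map (int_box 1 1 (fun m n k => (3 %| m - k)%Z /\ (3 %| n - k)%Z)) hexmx =
  adjoin (lattice_scale 3 Lambda36_10) (u1 + u2 + e3).
Proof.
rewrite lattice_scale_span2.
apply: (@hexagonal_adjoin_eq _ _ _ 3 0 0 3 1 1); try by hex_vectors.
move=> m n k; split=> [[/dvdzP[q hq] /dvdzP[q' hq']]|[r [s [-> ->]]]]; last by lia.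
by exists q, q'; lia.
Qed.

Lemma hexagonal_30_minus :
  lattice_map (int_box 1 1 (fun m n k => (3 %| m + k)%Z /\ (3 %| n + k)%Z)) hexmx =
  adjoin (lattice_scale 3 Lambda36_10) (2 *: u1 - u2 + e3).
Proof.
rewrite lattice_scale_span2.
apply: (@hexagonal_adjoin_eq _ _ _ 3 0 0 3 2 (-1)); try by hex_vectors.
move=> m n k; split=> [[/dvdzP[q hq] /dvdzP[q' hq']]|[r [s [-> ->]]]]; last by lia.
by exists (q - k), q'; lia.
Qed.

Lemma integral_vectorsE (D : set 'rV[int]_3) (C : int -> int -> int -> Prop) :
    (forall c, D c <-> C (c 0 0) (c 0 1) (c 0 2)) ->
  int_box 1 1 C = integral_vectors D :> set 'rV[R]_3.
Proof.
move=> DC; apply/seteqP; split=> [_ [m [n [k [Cmnk ->]]]]|_ [c /DC Cc <-]].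
  exists (\row_i nth 0 [:: m; n; k] i); first by apply/DC; rewrite !mxE.
  by rewrite !mul1r; apply: row3P; rewrite !mxE.
exists (c 0 0), (c 0 1), (c 0 2); split=> //.
by rewrite !mul1r; apply: row3P; rewrite mxE ptK.
Qed.

Lemma Lambda100_box : int_box 1 1 (fun _ _ _ => True) = Lambda100 :> set 'rV[R]_3.
Proof. exact: integral_vectorsE. Qed.

Lemma Lambda110_box :
  int_box 1 1 (fun m n k => (2 %| m + n + k)%Z) = Lambda110 :> set 'rV[R]_3.
Proof.
apply: integral_vectorsE => c /=; rewrite !big_ord_recl big_ord0 addr0 addrA.
rewrite (_ : lift ord0 ord0 = 1); last exact: val_inj.
by rewrite (_ : lift ord0 (lift ord0 ord0) = 2) //; apply: val_inj.
Qed.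

Lemma Lambda111_box :
  int_box 1 1 (fun m n k => (2 %| m - n)%Z /\ (2 %| n - k)%Z) = Lambda111 :> set 'rV[R]_3.
Proof.
apply: integral_vectorsE => c /=; split=> [h|[h1 h2] i j].
  by have := h 0 1; have := h 1 2; lia.
suff par l : (c 0%R l = c 0%R 0%R %[mod 2])%Z by rewrite !par.
case: l => -[|[|[|//]]] l3.
- by rewrite (_ : Ordinal l3 = 0) //; apply: val_inj.
- by rewrite (_ : Ordinal l3 = 1); [lia|apply: val_inj].
- by rewrite (_ : Ordinal l3 = 2); [lia|apply: val_inj].
Qed.

Lemma Lambda11_e3_box :
  int_box 1 1 (fun m n _ => (2 %| m + n)%Z) = adjoin Lambda11 e3 :> set 'rV[R]_3.
Proof.
have comb (r s k : int) : r%:~R *: (e1 + e2) + s%:~R *: (e1 - e2) + k%:~R *: e3 =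
    pt (1 * (r + s)%:~R) (1 * (r - s)%:~R) (1 * k%:~R) :> 'rV[R]_3.
  by rewrite /e1 /e2 /e3 !(ptZ, ptD, ptB); congr pt; ring.
rewrite adjoin_span2; apply/seteqP; split=> [_ [m [n [k [/dvdzP[q hq] ->]]]]|].
  exists q, (m - q), k; rewrite comb; congr pt; congr (1 * _%:~R); lia.
move=> _ [r [s [k ->]]]; rewrite comb.
by exists (r + s), (r - s), k; split=> //; lia.
Qed.

End HexagonalBasis.

(** * Symmetries of the hexagonal special groups *)

Section HexagonalSymmetries.
Variables (R : realType) (L : set 'rV[R]_3).
(** The lattice in hexagonal coordinates. *)
Let M := lattice_map L (invmx (hexmx R)).

Ltac hexagonal_part h :=
  apply: (hexagonal_linear h) => x y z; rewrite hexmxE ptB /sigma_x /sigma_y;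
  have s3 := congr1 (fun t => t * y) (sqrt3_sqr R); congr pt; lra.

Lemma hexagonal_mirror_symmetries alpha P :
    with_petrials [set P36_apeirogon alpha] P -> preserved_by L P ->
  (forall x y z, M (pt x y z) -> M (pt (- x - y) x z)) /\
  (forall x y z, M (pt x y z) -> M (pt (x + y) (- y) z)).
Proof.
move=> AP LP; have [|Q AQ [h0 h1 h2]] := preserved_by_petrials _ AP LP.
  by move=> Q -> p /=; rewrite [p]pt_eta /coord_map !ptK; congr pt; ring.
rewrite {Q}AQ in h0 h1 h2.
have r0 : forall x y z, M (pt x y z) -> M (pt (- x - y) y (- z)) by hexagonal_part h0.
have r1 : forall x y z, M (pt x y z) -> M (pt y x (- z)) by hexagonal_part h1.
have r2 : forall x y z, M (pt x y z) -> M (pt (x + y) (- y) z) by hexagonal_part h2.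
by split=> // x y z /r1/r0; congr (M (pt _ _ _)); ring.
Qed.

Lemma hexagonal_swap_symmetries alpha P :
    with_petrials [set P63_segment alpha] P -> preserved_by L P ->
  (forall x y z, M (pt x y z) -> M (pt (- x - y) x z)) /\
  (forall x y z, M (pt x y z) -> M (pt y x z)).
Proof.
move=> AP LP; have [|Q AQ [h0 h1 h2]] := preserved_by_petrials _ AP LP.
  by move=> Q -> p /=; rewrite [p]pt_eta /coord_map !ptK; congr pt; ring.
rewrite {Q}AQ in h0 h1 h2.
have r1 : forall x y z, M (pt x y z) -> M (pt y x z) by hexagonal_part h1.
have r2 : forall x y z, M (pt x y z) -> M (pt (- x - y) y z) by hexagonal_part h2.
by split=> // x y z /r1/r2; congr (M (pt _ _ _)); ring.
Qed.

(** For [{6,3}#{oo}] the reflection in the plane [z = 0] is the third power of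
    the linear part of [R_1 R_2], a rotary reflection of order six; it corrects the sign of the
    third coordinate in [R_0] and [R_1]. *)
Lemma hexagonal_full_symmetries alpha P :
    with_petrials [set P36; P63; P36_segment alpha; P63_apeirogon alpha] P ->
    preserved_by L P ->
  [/\ forall x y z, M (pt x y z) -> M (pt (- x - y) x z),
      forall x y z, M (pt x y z) -> M (pt (x + y) (- y) z) &
      forall x y z, M (pt x y z) -> M (pt y x z)].
Proof.
move=> AP LP; have [|Q AQ [h0 h1 h2]] := preserved_by_petrials _ AP LP.
  move=> Q [[[->|->]|->]|->] p /=; rewrite [p]pt_eta /coord_map !ptK; congr pt; ring.
case: AQ h0 h1 h2 => [[[->|->]|->]|->] h0 h1 h2.
- have r0 : forall x y z, M (pt x y z) -> M (pt (- x - y) y z) by hexagonal_part h0.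
  have r1 : forall x y z, M (pt x y z) -> M (pt y x z) by hexagonal_part h1.
  have r2 : forall x y z, M (pt x y z) -> M (pt (x + y) (- y) z) by hexagonal_part h2.
  by split=> // x y z /r1/r0; congr (M (pt _ _ _)); ring.
- have r0 : forall x y z, M (pt x y z) -> M (pt (x + y) (- y) z) by hexagonal_part h0.
  have r1 : forall x y z, M (pt x y z) -> M (pt y x z) by hexagonal_part h1.
  have r2 : forall x y z, M (pt x y z) -> M (pt (- x - y) y z) by hexagonal_part h2.
  by split=> // x y z /r1/r2; congr (M (pt _ _ _)); ring.
- have r1 : forall x y z, M (pt x y z) -> M (pt y x z) by hexagonal_part h1.
  have r2 : forall x y z, M (pt x y z) -> M (pt (x + y) (- y) z) by hexagonal_part h2.
  by split=> // x y z /r2/r1/r2/r1; congr (M (pt _ _ _)); ring.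
- have r0 : forall x y z, M (pt x y z) -> M (pt (x + y) (- y) (- z)) by hexagonal_part h0.
  have r1 : forall x y z, M (pt x y z) -> M (pt y x (- z)) by hexagonal_part h1.
  have r2 : forall x y z, M (pt x y z) -> M (pt (- x - y) y z) by hexagonal_part h2.
  have hz : forall x y z, M (pt x y z) -> M (pt x y (- z)).
    by move=> x y z /r1/r2/r1/r2/r1/r2; congr (M (pt _ _ _)); ring.
  split=> x y z; [move=> /r1/r2/hz|move=> /r0/hz|move=> /r1/hz];
    by congr (M (pt _ _ _)); ring.
Qed.

End HexagonalSymmetries.

(** * The classification *)

Theorem theorem4p11 (R : realType) (alpha : R) (alpha_gt0 : 0 < alpha)
    (P : generators R)
    (hP : (planar_apeirohedra `|` blended_apeirohedra alpha
             `|` pure_apeirohedra) P)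
    (L : set 'rV[R]_3) (hL : is_lattice_group 3 L)
    (hPL : symmetric_toroidal_realization L P) :
  (pure_apeirohedra P ->
    exists2 a : R, 0 < a &
      [set Lambda100; Lambda110; Lambda111] (lattice_scale a^-1 L))
  /\
  (with_petrials [set P44; P44_segment alpha; P44_apeirogon alpha] P ->
    exists a b : R, diag_aab a b \in unitmx /\
      [set Lambda100; Lambda110; Lambda111; adjoin (Lambda11) e3]
        (lattice_map L (invmx (diag_aab a b))))
  /\
  (with_petrials [set P36_apeirogon alpha] P ->
    exists a b : R, diag_aab a b \in unitmx /\
      [set adjoin (Lambda36_10) e3; adjoin (Lambda36_11) e3;
           adjoin (Lambda36_11) (u1 + e3); adjoin (Lambda36_11) (u2 + e3)]
        (lattice_map L (invmx (diag_aab a b))))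
  /\
  (with_petrials [set P63_segment alpha] P ->
    exists a b : R, diag_aab a b \in unitmx /\
      [set adjoin (Lambda36_10) e3; adjoin (Lambda36_11) e3;
           adjoin (lattice_scale 3 (Lambda36_10)) (u1 + u2 + e3);
           adjoin (lattice_scale 3 (Lambda36_10)) (2 *: u1 - u2 + e3)]
        (lattice_map L (invmx (diag_aab a b))))
  /\
  (with_petrials [set P36; P63; P36_segment alpha; P63_apeirogon alpha] P ->
    exists a b : R, diag_aab a b \in unitmx /\
      [set adjoin (Lambda36_10) e3; adjoin (Lambda36_11) e3]
        (lattice_map L (invmx (diag_aab a b)))).
Proof.
have LA := lattice_additive hL; have LP := realization_preserved LA hPL.
have ML := lattice_group_map (hexmx_unit R) hL.
have scale (a b : R) : 0 < a -> 0 < b -> diag_aab a b \in unitmx.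
  by move=> a0 b0; apply: diag_aab_unit; apply: lt0r_neq0.
split=> [pureP|].
  have [hx hxy hyz] := pure_symmetries LA pureP LP.
  have [a a0 cases] := cubic_lattices hL hx hxy hyz; exists a => //.
  have -> : lattice_scale a^-1 L = lattice_map L (invmx (diag_aab a a)).
    have aE : diag_aab a a = a%:M.
      by apply/matrixP => i j; rewrite !mxE; case: i j => -[|[|[|//]]] i3 [[|[|[|//]]] j3].
    by apply/eq_imagel => v _; rewrite aE invmx_scalar mul_mx_scalar.
  case: cases => /(lattice_map_int_box a0 a0) ->.
  - by left; left; apply: Lambda100_box.
  - by left; right; apply: Lambda110_box.
  - by right; apply: Lambda111_box.
split=> [AP|].
  have [hx hz hxy] := square_symmetries LA AP LP.
  have [a [b [a0 b0 cases]]] := square_lattices hL hx hz hxy.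
  exists a, b; split; first exact: scale.
  case: cases => /(lattice_map_int_box a0 b0) ->.
  - by left; left; left; apply: Lambda100_box.
  - by left; left; right; apply: Lambda110_box.
  - by left; right; apply: Lambda111_box.
  - by right; apply: Lambda11_e3_box.
split=> [AP|].
  have [hrot hm] := hexagonal_mirror_symmetries AP LP.
  have [a [b [a0 b0 cases]]] := hexagonal_lattices_mirror ML hrot hm.
  exists a, b; split; first exact: scale.
  case: cases => /(hexagonal_int_box a0 b0) ->.
  - by left; left; left; apply: hexagonal_10_e3.
  - by left; left; right; apply: hexagonal_11_e3.
  - by left; right; apply: hexagonal_11_u1.
  - by right; apply: hexagonal_11_u2.
split=> AP.
  have [hrot hs] := hexagonal_swap_symmetries AP LP.
  have [a [b [a0 b0 cases]]] := hexagonal_lattices_swap ML hrot hs.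
  exists a, b; split; first exact: scale.
  case: cases => /(hexagonal_int_box a0 b0) ->.
  - by left; left; left; apply: hexagonal_10_e3.
  - by left; left; right; apply: hexagonal_11_e3.
  - by left; right; apply: hexagonal_30_plus.
  - by right; apply: hexagonal_30_minus.
have [hrot hm hs] := hexagonal_full_symmetries AP LP.
have [a [b [a0 b0 cases]]] := hexagonal_lattices_mirror_swap ML hrot hm hs.
exists a, b; split; first exact: scale.
case: cases => /(hexagonal_int_box a0 b0) ->.
- by left; apply: hexagonal_10_e3.
- by right; apply: hexagonal_11_e3.
Qed.
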